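(* Consider the parallel Schwarz method with impedance transmission conditions for the two-dimensional transverse electric Maxwell wave-guide problem, with $\hat L>0$ fixed. Suppose that $\sigma=\sigma_0k$ for some constant $\sigma_0>0$, and consider a $k$-dependent domain decomposition given by $L=L_0k^{-1}$ and $\delta=\delta_0k^{-1}$ with constants $L_0,\delta_0>0$. Then the convergence factor $R_{2d}^{\mathrm M}$ can be bounded above by a value independent of $k>0$, and this bound becomes tight as $k\to\infty$ (i.e. $R_{2d}^{\mathrm M}$ tends to the bound as $k\to\infty$). As such, the convergence of the corresponding Schwarz method is ultimately independent of the wave number $k$ as it increases. Under the additional assumption that between them $\sigma_0$, $L_0$ and $\delta_0$ are sufficiently large (i.e., with any two of them fixed, whenever the remaining one exceeds some threshold depending on the fixed ones; in particular, whenever $\sigma_0\ge1$), one has $R_{2d}^{\mathrm M}<1$ and the approach is ultimately $k$-robust and independent of the number of subdomains.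
   Context: Domain $\Omega=(a_1,b_N)\times(0,\hat L)$ decomposed into $\Omega_j=(a_j,b_j)\times(0,\hat L)$, $j=1,\dots,N$, with $b_j-a_j=L+2\delta$, $b_{j-1}-a_j=2\delta$, $a_{j+1}-a_j=b_{j+1}-b_j=L$. The problem for $\mathbf{E}=(E_x,E_y)$ is $\mathcal{L}\mathbf{E}:=-k^2\mathbf{E}+\nabla\times(\nabla\times\mathbf{E})+ik\sigma\mathbf{E}=\mathbf{0}$, i.e. $-k^2E_x-\partial_{yy}E_x+\partial_{xy}E_y+ik\sigma E_x=0$ and $-k^2E_y-\partial_{xx}E_y+\partial_{xy}E_x+ik\sigma E_y=0$, with $E_x=0$ for $y\in\{0,\hat L\}$, $\mathcal{B}_l\mathbf{E}:=(-\partial_x+ik)E_y+\partial_yE_x=g_1$ at $x=a_1$ and $\mathcal{B}_r\mathbf{E}:=(\partial_x+ik)E_y-\partial_yE_x=-g_2$ at $x=b_N$. The parallel Schwarz method solves $\mathcal{L}\mathbf{E}_j^n=\mathbf{0}$ in $\Omega_j$ with $\mathcal{B}_l\mathbf{E}_j^n=\mathcal{B}_l\mathbf{E}_{j-1}^{n-1}$ at $x=a_j$, $\mathcal{B}_r\mathbf{E}_j^n=\mathcal{B}_r\mathbf{E}_{j+1}^{n-1}$ at $x=b_j$ (with the given boundary data at $x=a_1$ for $j=1$ and $x=b_N$ for $j=N$) and $E_{x,j}^n=0$ for $y\in\{0,\hat L\}$. Errors are expanded as $e_{x,j}^n=\sum_{m\ge1}v_j^n(x,\tilde k)\sin(\tilde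 ky)$, $e_{y,j}^n=\sum_{m\ge1}w_j^n(x,\tilde k)\cos(\tilde ky)$ with Fourier numbers $\tilde k=\frac{m\pi}{\hat L}$, $m\in\{1,2,\dots\}$. Each mode evolves independently and reduces to a one-dimensional Schwarz iteration for the equation $(ik\sigma+\tilde k^2-k^2)u-\partial_{xx}u=0$ with interface operators $\mp\partial_x+\alpha$, $\alpha=ik+\sigma$, whose interface data are multiplied at each iteration by the matrix $\mathcal{T}_{1d}^{\mathrm M}(\tilde k)$. Here $\mathcal{T}_{1d}^{\mathrm M}(\tilde k)\in\mathbb{C}^{2(N-1)\times2(N-1)}$ is the block tridiagonal block Toeplitz matrix with $2\times2$ blocks: diagonal blocks $A_0=\begin{bmatrix}0&b\\ b&0\end{bmatrix}$, first superdiagonal blocks $A_1=\begin{bmatrix}a&0\\0&0\end{bmatrix}$, first subdiagonal blocks $A_{-1}=\begin{bmatrix}0&0\\0&a\end{bmatrix}$, where $$a=\frac{(\zeta+\alpha)^2e^{2\zeta\delta}-(\zeta-\alpha)^2e^{-2\zeta\delta}}{(\zeta+\alpha)^2e^{\zeta(2\delta+L)}-(\zeta-\alpha)^2e^{-\zeta(2\delta+L)}},\qquad b=-\frac{(\zeta^2-\alpha^2)(e^{\zeta L}-e^{-\zeta L})}{(\zeta+\alpha)^2e^{\zeta(2\delta+L)}-(\zeta-\alpha)^2e^{-\zeta(2\delta+L)}},$$ with $\alpha=ik+\sigma$ and $\zeta=\zeta(\tilde k)=\sqrt{ik\sigma+\tilde k^2-k^2}$ (principal square root). With $\rho$ the spectral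 radius, $R_{1d}^{\mathrm M}(\tilde k):=\lim_{N\to\infty}\rho(\mathcal{T}_{1d}^{\mathrm M}(\tilde k))$ and $R_{2d}^{\mathrm M}:=\sup_{\tilde k}R_{1d}^{\mathrm M}(\tilde k)$, the supremum being over all $\tilde k=\frac{m\pi}{\hat L}$, $m\ge1$. ''$k$-robust'' means that the convergence factor does not ultimately depend on $k$ as $k$ increases. *)

(* Defs.v *)
From mathcomp Require Import all_boot all_order all_algebra.
From mathcomp Require Import complex.
From mathcomp Require Import all_classical all_reals all_analysis.

Set Implicit Arguments.
Unset Strict Implicit.
Unset Printing Implicit Defensive.

Import Order.TTheory GRing.Theory Num.Theory.
Import numFieldNormedType.Exports.

Local Open Scope classical_set_scope.
Local Open Scope ring_scope.
Local Open Scope complex_scope.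

(* The exponential of a complex number x + iy. *)
Definition cexp (R : realType) (z : R[i]) : R[i] :=
  (expR (complex.Re z) * cos (complex.Im z))
    +i* (expR (complex.Re z) * sin (complex.Im z)).

(* Real-valued spectral radius; the supremum is a maximum when n > 0, and is 0
   for the empty matrix. *)
Definition spectral_radius (R : realType) (n : nat) (A : 'M[R[i]]_n) : R :=
  sup [set ComplexField.Normc.normc l | l in [set l : R[i] | eigenvalue A l]].

Definition mx2 (T : pzSemiRingType) (p q r s : T) : 'M[T]_2 :=
  \matrix_(i < 2, j < 2)
    nth 0 (nth [::] [:: [:: p; q]; [:: r; s]] i) j.

(* N.-1 x N.-1 blocks, each 2 x 2. *)
Definition block_tridiag_toeplitz (T : pzSemiRingType) (N : nat)
    (Am1 A0 A1 : 'M[T]_2) : 'M[T]_(\sum_(i < N.-1) 2) :=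
  \mxblock_(i < N.-1, j < N.-1)
    (if i == j :> nat then A0
     else if j == i.+1 :> nat then A1
     else if i == j.+1 :> nat then Am1
     else 0).

Section SchwarzMaxwell.
Variables (R : realType).

(* k : wave number; sigma : conductivity; L, delta : geometry of the strips
   (subdomain length L + 2 delta, overlap 2 delta); kt : Fourier number. *)
Variables (k sigma L delta : R).

Definition alpha : R[i] := 'i * k%:C + sigma%:C.

(* [sqrtc] is the principal square root. *)
Definition zeta (kt : R) : R[i] :=
  sqrtc ('i * (k * sigma)%:C + (kt ^+ 2)%:C - (k ^+ 2)%:C).

Definition coef_den (kt : R) : R[i] :=
  let z := zeta kt in
  (z + alpha) ^+ 2 * cexp (z * (2 * delta + L)%:C)
  - (z - alpha) ^+ 2 * cexp (- z * (2 * delta + L)%:C).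

Definition coef_a (kt : R) : R[i] :=
  let z := zeta kt in
  ((z + alpha) ^+ 2 * cexp (2 * z * delta%:C)
   - (z - alpha) ^+ 2 * cexp (- 2 * z * delta%:C)) / coef_den kt.

Definition coef_b (kt : R) : R[i] :=
  let z := zeta kt in
  - ((z ^+ 2 - alpha ^+ 2) * (cexp (z * L%:C) - cexp (- z * L%:C)))
  / coef_den kt.

(* Iteration matrix T_1d^M(kt) for N subdomains. *)
Definition T1d (N : nat) (kt : R) : 'M[R[i]]_(\sum_(i < N.-1) 2) :=
  let a := coef_a kt in
  let b := coef_b kt in
  block_tridiag_toeplitz N (mx2 0 0
                                0 a)
                           (mx2 0 b
                                b 0)
                           (mx2 a 0
                                0 0).

(* Meaningful when the limit exists. *)
Definition R1d (kt : R) : R := limn (fun N => spectral_radius (T1d N kt)).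

Definition fourier_number (Lhat : R) (m : nat) : R := m%:R * pi / Lhat.

(* The supremum is taken in the extended reals, so it is never a default
   value. *)
Definition R2d (Lhat : R) : \bar R :=
  ereal_sup [set (R1d (fourier_number Lhat m))%:E | m in [set m | (0 < m)%N]].

End SchwarzMaxwell.

Arguments fourier_number {R}.

(* Main.v *)
Require Import Defs.
From mathcomp Require Import all_boot all_order all_algebra.
From mathcomp Require Import complex ring lra.
From mathcomp Require Import all_classical all_reals all_analysis.

(** Measuring lengths in units of 1 / k, every matrix entry depends on k and on
    the Fourier number only through the ratio s = kt / k ([T1d_scale]).  The
    convergence factor is therefore the supremum of one function [rate] over the
    points s = m pi / (Lhat k), and the bound is its supremum over all s > 0.
    These points have spacing pi / (Lhat k), so as k grows they fill the half
    line, and continuity of [rate] makes the bound tight ([cvg_R2d_bound]).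

    The function [rate] comes from the limit of many subdomains: the spectral
    radius of the iteration matrix tends to max (|a + b|, |a - b|)
    ([cvg_spectral_radius_strip]).  This number bounds the operator norm for
    every size ([eigenvalue_strip_le]).  It is approached because the
    characteristic polynomial in the square of the eigenvalue satisfies a
    recurrence with a double characteristic root at the edges (a + b) ^ 2 and
    (a - b) ^ 2; compared with its derivative it is so small there that a root
    lies within O(1 / n) of the edge ([eigenvalue_strip_near]).  Both a and b
    are nonzero since z = zeta and alpha lie in the open first quadrant and
    z ^ 2 and alpha ^ 2 have imaginary parts sigma0 and 2 sigma0.

    For robustness, a + b and a - b are quotients F (delta - L / 2) /
    F (delta + L / 2) of functions F x = (z + alpha) e ^ (z x) -
    eps (z - alpha) e ^ (- z x) with eps = 1 or -1 ([coef_edge]).  Keeping only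
    the growing exponential bounds them by (X + Y) / (1 - X Y), where
    X = e ^ (- Re z * L) and Y = e ^ (- 2 Re z * delta) ([cmod_coef_edge_le]).
    Since Re z is smallest at s = 0, a large L or a large delta makes this less
    than 1 uniformly in s.  For sigma0 >= 1 the quotient is less than 1 for
    each s >= 0, because |F (delta + h)| ^ 2 - |F (delta - h)| ^ 2 is positive:
    hyperbolic sines dominate their arguments, which dominate the circular
    sines, and what is left are two polynomial inequalities between the real
    and imaginary parts of z ([edge_energy_lt]).  As [rate] is continuous on
    s >= 0 and decays at infinity, its supremum is then less than 1 too
    ([rate_bound_lt1]). *)

Set Implicit Arguments.
Unset Strict Implicit.
Unset Printing Implicit Defensive.

Import Order.TTheory GRing.Theory Num.Theory.
Import numFieldNormedType.Exports.

Local Open Scope classical_set_scope.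
Local Open Scope ring_scope.

(** * The modulus of a complex number, and roots near a point *)

(** Coercing the modulus to the carrier of [R] once and for all lets the order
    lemmas of a [realType] apply to it directly. *)
Definition cmod {R : realType} (z : R[i]) : R := ComplexField.Normc.normc z.

Section Modulus.
Variable R : realType.

Implicit Types x y z : R[i].

Lemma cmod_ge0 z : 0 <= cmod z.
Proof. by case: z => u v; rewrite /= sqrtr_ge0. Qed.

Lemma cmod_sqr z : cmod z ^+ 2 = complex.Re z ^+ 2 + complex.Im z ^+ 2.
Proof. by case: z => u v; rewrite /= sqr_sqrtr// addr_ge0 ?sqr_ge0. Qed.

Lemma cmod0 : cmod (0 : R[i]) = 0.
Proof. exact: ComplexField.Normc.normc0. Qed.

Lemma cmod1 : cmod (1 : R[i]) = 1.
Proof. exact: ComplexField.Normc.normc1. Qed.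

Lemma cmodM x y : cmod (x * y) = cmod x * cmod y.
Proof. exact: ComplexField.Normc.normcM. Qed.

Lemma cmodV x : cmod x^-1 = (cmod x)^-1.
Proof. exact: ComplexField.Normc.normcV. Qed.

Lemma cmodX x n : cmod (x ^+ n) = cmod x ^+ n.
Proof. by elim: n => [|n IH]; rewrite ?cmod1// !exprS cmodM IH. Qed.

Lemma cmod_triangle x y : cmod (x + y) <= cmod x + cmod y.
Proof. exact: le_normcD. Qed.

Lemma cmodN x : cmod (- x) = cmod x.
Proof. exact: normcN. Qed.

Lemma cmod_eq0 x : (cmod x == 0) = (x == 0).
Proof.
by apply/eqP/eqP => [/ComplexField.Normc.eq0_normc//|->]; rewrite cmod0.
Qed.

Lemma cmod_gt0 x : (0 < cmod x) = (x != 0).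
Proof. by rewrite lt_def cmod_ge0 cmod_eq0 andbT. Qed.

Lemma cmod_nat n : cmod (n%:R : R[i]) = n%:R.
Proof.
have -> : n%:R = ((n%:R : R)%:C)%C :> R[i] by rewrite rmorph_nat.
by rewrite /= expr0n addr0 sqrtr_sqr ger0_norm.
Qed.

Lemma cmod_triangle_sub x y : cmod x - cmod y <= cmod (x + y).
Proof.
rewrite lerBlDr -(cmodN y).
by apply: le_trans (cmod_triangle _ _); rewrite addrK.
Qed.

Lemma cmod_parallelogram x y :
  cmod (x + y) ^+ 2 + cmod (x - y) ^+ 2
  = 2 * (cmod x ^+ 2 + cmod y ^+ 2).
Proof. by rewrite !cmod_sqr; case: x => ? ?; case: y => ? ? /=; ring. Qed.

(** The map (u, v) |-> (b u + a v, b v + a u) is diagonal in the coordinates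
    u + v and u - v, with eigenvalues a + b and b - a; the parallelogram
    identity turns this into an operator norm bound. *)
Lemma cmod_swap_le (a b u v : R[i]) (M : R) :
  cmod (a + b) <= M -> cmod (a - b) <= M ->
  cmod (b * u + a * v) ^+ 2 + cmod (b * v + a * u) ^+ 2
  <= M ^+ 2 * (cmod u ^+ 2 + cmod v ^+ 2).
Proof.
move=> hp hm; set g := b * u + a * v; set h := b * v + a * u.
have e1 : g + h = (a + b) * (u + v) by rewrite /g /h; ring.
have e2 : g - h = - ((a - b) * (u - v)) by rewrite /g /h; ring.
have := cmod_parallelogram g h; rewrite e1 e2 cmodN !cmodM !exprMn => E.
have := cmod_parallelogram u v => F.
have hp2 : cmod (a + b) ^+ 2 <= M ^+ 2 by rewrite lerXn2r ?nnegrE ?(le_trans _ hp) ?cmod_ge0.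
have hm2 : cmod (a - b) ^+ 2 <= M ^+ 2 by rewrite lerXn2r ?nnegrE ?(le_trans _ hm) ?cmod_ge0.
have := ler_wpM2r (sqr_ge0 (cmod (u + v))) hp2.
have := ler_wpM2r (sqr_ge0 (cmod (u - v))) hm2.
move=> k1 k2.
have k3 := congr1 (fun t => M ^+ 2 * t) F; rewrite /= mulrDr in k3.
lra.
Qed.

(** The logarithmic derivative p' / p is the sum of the 1 / (x - r) over the
    roots r, so if all roots were at distance at least [eps] from [x] then
    |p'(x)| <= deg p / eps * |p(x)|. *)
Lemma monic_root_near (p : {poly R[i]}) (x : R[i]) (eps : R) :
  p \is monic -> 0 < eps ->
  (size p).-1%:R * cmod p.[x] < eps * cmod p^`().[x] ->
  exists2 r, root p r & cmod (x - r) < eps.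
Proof.
move=> pm e0 hlt.
have [rs ps] := closed_field_poly_normal p.
rewrite (monicP pm) scale1r in ps.
have [/hasP[r rin hr]|/hasPn far] := boolP (has (fun r => cmod (x - r) < eps) rs).
  by exists r => //; rewrite ps root_prod_XsubC.
exfalso; move: hlt; rewrite ps size_prod_XsubC /= ltNge => /negP; apply.
elim: rs far {ps} => [|r rs IH] far.
  by rewrite big_nil derivC !hornerE cmod0 mulr0.
rewrite big_cons derivM derivXsubC mul1r !hornerE.
set P := (\prod_(j <- rs) _).[x] in IH *.
set D := (_^`()).[x] in IH *.
have {}IH : eps * cmod D <= (size rs)%:R * cmod P.
  by apply: IH => s sin; apply: far; rewrite inE sin orbT.
have hr : eps <= cmod (x - r) by rewrite leNgt far// mem_head.
rewrite /= cmodM mulrCA.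
have h1 := cmod_triangle P ((x - r) * D); rewrite cmodM in h1.
have h2 := ler_wpM2l (cmod_ge0 (x - r)) IH.
have h3 := ler_wpM2r (cmod_ge0 P) hr.
have h4 := ler_wpM2l (ltW e0) h1.
rewrite -natr1.
lra.
Qed.

End Modulus.

(** * Spectrum of the block tridiagonal matrix *)

Section StripMatrix.
Variable R : realType.
Local Notation C := R[i].
Variables a b : C.

(** The iteration matrix on [n] blocks, i.e. for [n.+1] subdomains. *)
Definition strip_mx (n : nat) : 'M[C]_(\sum_(i < n) 2) :=
  block_tridiag_toeplitz n.+1 (mx2 0 0 0 a) (mx2 0 b b 0) (mx2 a 0 0 0).

Definition prev_entry (p : nat -> C) (i : nat) : C := if i is j.+1 then p j else 0.

(** Left eigenvectors are described by the two scalar sequences of their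
    blocks, which turns the eigenvalue equation into a recurrence. *)
Definition strip_row (n : nat) (p q : nat -> C) : 'rV[C]_(\sum_(i < n) 2) :=
  \mxrow_(i < n) (\row_(j < 2) nth 0 [:: p i; q i] j).

Lemma strip_row_eqP n p q p' q' :
  strip_row n p q = strip_row n p' q' <->
  forall i, (i < n)%N -> p i = p' i /\ q i = q' i.
Proof.
rewrite /strip_row -eq_mxrowP; split=> [e i lin|e i].
  have /rowP ei := e (Ordinal lin).
  have := ei 0; have := ei 1; rewrite !mxE /= => <- <-.
  by [].
by have [-> ->] := e i (ltn_ord i).
Qed.

Lemma strip_rowP n (v : 'rV[C]_(\sum_(i < n) 2)) :
  exists p q, q n = 0 /\ v = strip_row n p q.
Proof.
pose f (j : 'I_2) (i : nat) : C :=
  if insub i is Some k then submxrow v k 0 j else 0.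
exists (f 0), (f 1); split; first by rewrite /f insubF ?ltnn.
rewrite -[LHS]submxrowK; apply: eq_mxrow => i.
apply/rowP => j; rewrite [RHS]mxE /f valK.
by case: j => [[|[|//]] hj] /=; congr (_ _ _); apply: val_inj.
Qed.

Lemma mul_strip_row n p q : q n = 0 ->
  strip_row n p q *m strip_mx n =
  strip_row n (fun i => b * q i + a * prev_entry p i)
              (fun i => b * p i + a * q i.+1).
Proof.
move=> qn; rewrite /strip_row /strip_mx /block_tridiag_toeplitz mul_mxrow_mxblock.
apply: eq_mxrow => j.
pose e (i : nat) : 'rV[C]_2 := \row_(l < 2) nth 0 [:: p i; q i] l.
have contrib (i : 'I_n) :
    (if i == j :> nat then mx2 0 b b 0
     else if j == i.+1 :> nat then mx2 a 0 0 0
     else if i == j.+1 :> nat then mx2 0 0 0 a else 0) =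
    (if i == j :> nat then mx2 0 b b 0 else 0)
    + (if j == i.+1 :> nat then mx2 a 0 0 0 else 0)
    + (if i == j.+1 :> nat then mx2 0 0 0 a else 0) :> 'M[C]_2.
  have [->|] := eqVneq (i : nat) j.
    by rewrite (ltn_eqF (ltnSn j)) !addr0.
  have [->|] := eqVneq (j : nat) i.+1; last by rewrite !add0r.
  by rewrite (ltn_eqF (ltnW (ltnSn i.+1))) add0r addr0.
transitivity (\sum_(i < n) (e i *m (if i == j :> nat then mx2 0 b b 0 else 0)
    + e i *m (if j == i.+1 :> nat then mx2 a 0 0 0 else 0)
    + e i *m (if i == j.+1 :> nat then mx2 0 0 0 a else 0)) : 'rV[C]_2).
  by apply: eq_bigr => i _; rewrite contrib !mulmxDr.
rewrite !big_split /=.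
have pick (k : nat) (X : 'M[C]_2) :
    \sum_(i < n) e i *m (if i == k :> nat then X else 0)
    = (if (k < n)%N then e k *m X else 0).
  case: ltnP => hk.
    rewrite (bigD1 (Ordinal hk))//= eqxx big1 ?addr0// => i.
    by rewrite -val_eqE /= => /negbTE ->; rewrite mulmx0.
  apply: big1 => i _; case: eqP => [ik|]; last by rewrite mulmx0.
  by move: (ltn_ord i); rewrite ik ltnNge hk.
rewrite !pick ltn_ord.
have -> : \sum_(i < n) e i *m (if j == i.+1 :> nat then mx2 a 0 0 0 else 0)
    = (if (j : nat) is k.+1 then e k *m mx2 a 0 0 0 else 0).
  case: j {contrib} => -[|k] hk /=; first by rewrite big1// => i _; rewrite mulmx0.
  under eq_bigr do rewrite eqSS eq_sym.
  by rewrite pick (ltn_trans _ hk).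
have em k (u w s t : C) : e k *m mx2 u w s t =
    \row_(l < 2) nth 0 [:: p k * u + q k * s; p k * w + q k * t] l.
  apply/rowP => l; rewrite !mxE big_ord_recl big_ord1 !mxE /=.
  by case: l => [[|[|//]] hl].
rewrite !em.
apply/rowP => l; rewrite !mxE.
have qS : (if (j.+1 < n)%N then q j.+1 * a else 0) = a * q j.+1.
  case: ltnP => h; first by rewrite mulrC.
  by rewrite (_ : j.+1 = n) ?qn ?mulr0//; apply/eqP; rewrite eqn_leq h ltn_ord.
have -> : (if (j.+1 < n)%N
    then \row_(l0 < 2) nth 0 [:: p j.+1 * 0 + q j.+1 * 0;
                                 p j.+1 * 0 + q j.+1 * a] l0
    else 0) 0 l = nth 0 [:: 0; a * q j.+1] l.
  by rewrite -qS; case: ifP => _; rewrite mxE; case: l => [[|[|//]] hl] /=; ring.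
have -> : (match (j : nat) with 0%N => 0 | k.+1 => e k *m mx2 a 0 0 0 end) 0 l
    = nth 0 [:: a * prev_entry p j; 0] l.
  by case: (nat_of_ord j) => [|k]; rewrite ?em mxE; case: l => [[|[|//]] hl] /=; ring.
by case: l => [[|[|//]] hl] /=; ring.
Qed.

Lemma eigenvalue_stripP n (l : C) :
  eigenvalue (strip_mx n) l <->
  exists p q, [/\ q n = 0,
    exists2 i, (i < n)%N & (p i != 0) || (q i != 0)
    & forall i, (i < n)%N -> l * p i = b * q i + a * prev_entry p i
                          /\ l * q i = b * p i + a * q i.+1].
Proof.
have scale p q : l *: strip_row n p q =
    strip_row n (fun i => l * p i) (fun i => l * q i).
  apply/mxrowP => i.
  have -> (x : 'rV[C]_(\sum_(i < n) 2)) : submxrow (l *: x) i = l *: submxrow x i.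
    by apply/rowP => j; rewrite !mxE.
  rewrite /strip_row !mxrowK; apply/rowP => j; rewrite !mxE.
  by case: j => [[|[|//]] hj].
have zero : 0 = strip_row n (fun=> 0) (fun=> 0).
  apply/mxrowP => i; rewrite /strip_row mxrowK; apply/rowP => j; rewrite !mxE.
  by case: j => [[|[|//]] hj].
split=> [/eigenvalueP[v vT v0]|[p [q [qn [i lin nz] e]]]].
  have [p [q [qn vE]]] := strip_rowP v.
  exists p, q; split=> //.
    apply: contrapT => H; move/eqP: v0; apply; rewrite vE zero.
    apply/strip_row_eqP => i lin.
    have [->|p0] := eqVneq (p i) 0; have [->|q0] := eqVneq (q i) 0; split=> //;
      exfalso; apply: H; exists i; rewrite // ?p0 ?q0 ?orbT//.
  move: vT; rewrite vE mul_strip_row// scale => /strip_row_eqP E i lin.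
  by have [-> ->] := E i lin.
apply/eigenvalueP; exists (strip_row n p q).
  rewrite mul_strip_row// scale; apply/strip_row_eqP => j lj.
  by have [-> ->] := e j lj.
apply/eqP; rewrite zero => /strip_row_eqP/(_ i lin)[pi qi].
by move: nz; rewrite pi qi eqxx.
Qed.

(** The block structure hides a decoupling: interface [j] mixes only the pair
    (p (j-1), q j), through the map bounded in [cmod_swap_le].  Summing over
    the interfaces bounds the Euclidean operator norm by [M]; the two end
    interfaces see a zero because of p (-1) = q n = 0. *)
Lemma eigenvalue_strip_le n (l : C) (M : R) :
  cmod (a + b) <= M -> cmod (a - b) <= M ->
  eigenvalue (strip_mx n) l -> cmod l <= M.
Proof.
move=> hp hm /eigenvalue_stripP[p [q [qn [i0 li0 nz] e]]].
pose E := \sum_(i < n) (cmod (p i) ^+ 2 + cmod (q i) ^+ 2).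
have M0 : 0 <= M by apply: le_trans hp; exact: cmod_ge0.
have E0 : 0 < E.
  rewrite /E (bigD1 (Ordinal li0))//= ltr_pwDl//; last first.
    by apply: sumr_ge0 => i _; rewrite addr_ge0 ?sqr_ge0.
  case/orP: nz => nz.
    by rewrite ltr_pwDl ?sqr_ge0// exprn_gt0// cmod_gt0.
  by rewrite ltr_wpDl ?sqr_ge0// exprn_gt0// cmod_gt0.
suff H : cmod l ^+ 2 * E <= M ^+ 2 * E.
  by rewrite ler_pM2r// ler_pXn2r ?nnegrE ?cmod_ge0// in H.
pose f j := cmod (b * q j + a * prev_entry p j) ^+ 2.
pose g j := cmod (b * prev_entry p j + a * q j) ^+ 2.
have -> : cmod l ^+ 2 * E = \sum_(i < n) f i + \sum_(i < n) g i.+1.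
  rewrite -big_split mulr_sumr; apply: eq_bigr => i _ /=.
  have [e1 e2] := e i (ltn_ord i).
  by rewrite /f /g -e1 -e2 !cmodM !exprMn -mulrDr.
have hf : \sum_(i < n) f i <= \sum_(i < n.+1) f i.
  by rewrite big_ord_recr /= lerDl sqr_ge0.
have hg : \sum_(i < n) g i.+1 <= \sum_(i < n.+1) g i.
  by rewrite big_ord_recl /= lerDr sqr_ge0.
apply: le_trans (lerD hf hg) _; rewrite -big_split /=.
have -> : E = \sum_(i < n.+1) (cmod (q i) ^+ 2 + cmod (prev_entry p i) ^+ 2).
  rewrite /E !big_split /= addrC big_ord_recr/= qn cmod0 expr0n addr0; congr +%R.
  by rewrite [RHS]big_ord_recl {1}/prev_entry /= !expr0n /= addr0 sqrtr0 expr0n add0r.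
by rewrite mulr_sumr; apply: ler_sum => i _; exact: cmod_swap_le.
Qed.

(** Solving the eigenvector recurrence from p (-1) = 0, q 0 = 1 gives
    q j = Q_j / (a l) ^ j and p j = P_j / ((a l) ^ j * l), where Q_j and P_j
    are these polynomials evaluated at l ^ 2.  The closing condition q n = 0
    then says that Q_n vanishes, so Q_n is the characteristic polynomial in
    the variable l ^ 2. *)
Fixpoint strip_poly (n : nat) : {poly C} * {poly C} :=
  if n is m.+1 then
    let Q := 'X * (strip_poly m).1 - b *: (strip_poly m).2 in
    (Q, b *: Q + a ^+ 2 *: (strip_poly m).2)
  else (1, b%:P).

Lemma strip_poly_size n :
  [/\ size (strip_poly n).1 = n.+1, (strip_poly n).1 \is monic
    & (size (strip_poly n).2 <= n.+1)%N].
Proof.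
elim: n => [|n [sQ mQ sP]] /=.
  by split; [exact: size_poly1 | exact: monic1 | exact: size_polyC_leq1].
set Q := 'X * _ - _.
have sXQ : size ('X * (strip_poly n).1) = n.+2.
  by rewrite size_monicM ?monicX// ?size_polyX ?sQ// monic_neq0.
have lt : (size (- (b *: (strip_poly n).2))%R < size ('X * (strip_poly n).1)%R)%N.
  by rewrite sXQ size_polyN ltnS (leq_trans (size_scale_leq _ _)).
have sQ' : size Q = n.+2 by rewrite /Q size_polyDl.
split=> //.
  by rewrite monicE lead_coefDl// lead_coefM lead_coefX mul1r -monicE.
rewrite (leq_trans (size_polyD _ _))// geq_max.
rewrite (leq_trans (size_scale_leq _ _)) ?sQ'//.
by rewrite (leq_trans (size_scale_leq _ _))// ltnW.
Qed.

Lemma strip_poly_root_eigenvalue n (l : C) : a != 0 -> l != 0 -> (0 < n)%N ->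
  root (strip_poly n).1 (l ^+ 2) -> eigenvalue (strip_mx n) l.
Proof.
move=> a0 l0 n0 /rootP rQ; apply/eigenvalue_stripP.
exists (fun i => (strip_poly i).2.[l ^+ 2] / ((a * l) ^+ i * l)).
exists (fun i => (strip_poly i).1.[l ^+ 2] / (a * l) ^+ i).
split; first by rewrite rQ mul0r.
  by exists 0%N; rewrite //= !hornerE expr0 invr1 oner_neq0 orbT.
have X0 j : (a * l) ^+ j != 0 by rewrite expf_neq0 ?mulf_neq0.
have h1 x : (1 : {poly C}).[x] = 1 by exact: hornerC.
move=> [|i] lin; split;
  rewrite /= ?(hornerD, hornerN, hornerM, hornerZ, hornerX, hornerC, h1) ?exprS ?expr0.
- by field; rewrite l0.
- by field; rewrite l0 a0.
- by field; rewrite l0 a0 X0.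
- by field; rewrite l0 a0 X0.
Qed.

(** At l = a + b the two characteristic roots of the recurrence coincide (an
    edge of the limiting spectrum), so the solutions are powers times
    polynomials in [n], of degree at most 1 for the values and 3 for the
    derivatives. *)
Lemma strip_poly_at_edge n : a != 0 -> a + b != 0 ->
  let x := (a + b) ^+ 2 in let m := n%:R in let d := (a * (a + b)) ^+ n in
  [/\ (strip_poly n).1.[x] = d * (1 + m * b / (a + b)),
      (strip_poly n).2.[x] = d * b * (m + 1),
      (strip_poly n).1^`().[x] = d * (b ^+ 2 * m ^+ 3
        + (6 * a * b + 3 * b ^+ 2) * m ^+ 2
        + (6 * a ^+ 2 + 6 * a * b + 2 * b ^+ 2) * m) / (6 * a * (a + b) ^+ 3)
    & (strip_poly n).2^`().[x] = d * (b ^+ 2 * m ^+ 3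
        + (3 * a * b + 3 * b ^+ 2) * m ^+ 2
        + (3 * a * b + 2 * b ^+ 2) * m) / (6 * a * (a + b) ^+ 2)].
Proof.
move=> a0 l0 /=; have six : 6 != 0 :> C by rewrite pnatr_eq0.
elim: n => [|n [eQ eP dQ dP]] /=.
  have h1 x : (1 : {poly C}).[x] = 1 by exact: hornerC.
  have d1 : (1 : {poly C})^`() = 0 by exact: derivC.
  by split; rewrite ?d1 ?derivC ?h1 ?hornerC ?expr0 ?mulr0n;
    field; rewrite ?l0 ?a0.
have h1 : ('X * (strip_poly n).1 - b *: (strip_poly n).2).[(a + b) ^+ 2] =
    (a * (a + b)) ^+ n.+1 * (1 + n.+1%:R * b / (a + b)).
  rewrite !(hornerD, hornerN, hornerM, hornerZ, hornerX) eQ eP -natr1.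
  by rewrite (exprS (a * (a + b))); field; rewrite ?l0 ?a0.
have h2 : ('X * (strip_poly n).1 - b *: (strip_poly n).2)^`().[(a + b) ^+ 2] =
  (a * (a + b)) ^+ n.+1 * (b ^+ 2 * n.+1%:R ^+ 3
        + (6 * a * b + 3 * b ^+ 2) * n.+1%:R ^+ 2
        + (6 * a ^+ 2 + 6 * a * b + 2 * b ^+ 2) * n.+1%:R) / (6 * a * (a + b) ^+ 3).
  rewrite derivB derivM derivX derivZ mul1r.
  rewrite !(hornerD, hornerN, hornerM, hornerZ, hornerX) eQ dQ dP -natr1.
  rewrite (exprS (a * (a + b))).
  by field; rewrite ?l0 ?a0.
split=> //.
- by rewrite hornerD !hornerZ h1 eP -natr1 (exprS (a * (a + b))); field; rewrite ?l0 ?a0.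
- rewrite derivD !derivZ hornerD !hornerZ h2 dP -natr1 (exprS (a * (a + b))).
  by field; rewrite ?l0 ?a0.
Qed.

(** At the edge, Q_n / Q_n' is of order n ^ -2 while Q_n has degree [n], so
    [monic_root_near] finds a root within O(1 / n) of (a + b) ^ 2. *)
Lemma eigenvalue_strip_near (eps : R) : a != 0 -> b != 0 -> a + b != 0 ->
  0 < eps ->
  \forall n \near \oo, exists2 l, eigenvalue (strip_mx n) l &
    cmod (a + b) ^+ 2 - eps < cmod l ^+ 2.
Proof.
move=> a0 b0 l0 e0.
wlog esmall : eps e0 / eps <= cmod (a + b) ^+ 2.
  move=> H; pose e := Num.min eps (cmod (a + b) ^+ 2).
  have ee : e <= eps by rewrite ge_min lexx.
  have ep : 0 < e by rewrite lt_min e0 exprn_gt0// cmod_gt0.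
  have el : e <= cmod (a + b) ^+ 2 by rewrite ge_min lexx orbT.
  have := H e ep el; apply: filterS => n [l hl lt]; exists l => //.
  by apply: le_lt_trans lt; rewrite lerB.
(* K is the inverse of the constant denominator of Q_n' at the edge, and the
   C_i are the moduli of the coefficients of the cubic; C3 is nonzero because b
   is. *)
pose B := cmod (b / (a + b)).
pose K : C := (6 * a * (a + b) ^+ 3)^-1.
pose C3 := cmod (K * b ^+ 2).
pose C2 := cmod (K * (6 * a * b + 3 * b ^+ 2)).
pose C1 := cmod (K * (6 * a ^+ 2 + 6 * a * b + 2 * b ^+ 2)).
have C3p : 0 < eps * C3.
  by rewrite mulr_gt0// cmod_gt0 mulf_neq0 ?expf_neq0// invr_neq0// !mulf_neq0// expf_neq0.
have : \forall n \near \oo, (1 + B + eps * (C1 + C2)) / (eps * C3) < n%:R :> R.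
  exact: nbhs_infty_gtr.
move=> big; near=> n.
have n0 : (0 < n)%N by near: n; exists 1%N.
have nbig : 1 + B + eps * (C1 + C2) < eps * C3 * n%:R.
  rewrite [ltRHS]mulrC -ltr_pdivrMr//; near: n; exact: big.
have [sQ mQ _] := strip_poly_size n.
have [eQ _ dQ _] := @strip_poly_at_edge n a0 l0.
have n1 : 1 <= n%:R :> R by rewrite ler1n.
set m : C := n%:R in eQ dQ.
have dQ' : (strip_poly n).1^`().[(a + b) ^+ 2] = (a * (a + b)) ^+ n *
    (K * b ^+ 2 * m ^+ 3 + (K * (6 * a * b + 3 * b ^+ 2) * m ^+ 2
     + K * (6 * a ^+ 2 + 6 * a * b + 2 * b ^+ 2) * m)).
  by rewrite dQ /K; field; rewrite ?l0 ?a0.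
have [|r rr hr] := @monic_root_near R (strip_poly n).1 ((a + b) ^+ 2) eps mQ e0.
  rewrite sQ eQ dQ' 2!(cmodM ((a * (a + b)) ^+ n)).
  set D := cmod (_ ^+ n); have D0 : 0 < D.
    by rewrite cmod_gt0 expf_neq0// mulf_neq0.
  rewrite !(mulrCA _ D) ltr_pM2l//.
  have u1 : cmod (1 + m * b / (a + b)) <= n%:R * (1 + B).
    apply: le_trans (cmod_triangle _ _) _.
    by rewrite cmod1 -mulrA cmodM cmod_nat mulrDr mulr1 lerD2r.
  have u2 := cmod_triangle_sub (K * b ^+ 2 * m ^+ 3)
    (K * (6 * a * b + 3 * b ^+ 2) * m ^+ 2
     + K * (6 * a ^+ 2 + 6 * a * b + 2 * b ^+ 2) * m).
  have u3 := cmod_triangle (K * (6 * a * b + 3 * b ^+ 2) * m ^+ 2)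
     (K * (6 * a ^+ 2 + 6 * a * b + 2 * b ^+ 2) * m).
  rewrite !(cmodM _ (m ^+ _)) ?(cmodM _ m) !(cmodX m) ?cmod_nat in u2 u3.
  rewrite -[cmod (K * b ^+ 2)]/C3 in u2; rewrite -/C1 -/C2 in u3.
  apply: (@le_lt_trans _ _ (n%:R ^+ 2 * (1 + B))).
    by rewrite expr2 -[leRHS]mulrA; apply: ler_wpM2l.
  have u4 : C1 * n%:R <= C1 * n%:R ^+ 2.
    by rewrite ler_wpM2l ?cmod_ge0// expr2 ler_peMr.
  have u5 : C3 * n%:R ^+ 3 - (C2 * n%:R ^+ 2 + C1 * n%:R ^+ 2)
      <= cmod (K * b ^+ 2 * m ^+ 3 + (K * (6 * a * b + 3 * b ^+ 2) * m ^+ 2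
     + K * (6 * a ^+ 2 + 6 * a * b + 2 * b ^+ 2) * m)) by lra.
  have := ler_wpM2l (ltW e0) u5.
  apply: lt_le_trans.
  rewrite -subr_gt0.
  have -> : eps * (C3 * n%:R ^+ 3 - (C2 * n%:R ^+ 2 + C1 * n%:R ^+ 2))
      - n%:R ^+ 2 * (1 + B) =
    n%:R ^+ 2 * (eps * C3 * n%:R - (1 + B + eps * (C1 + C2))) by ring.
  by rewrite mulr_gt0 ?subr_gt0// exprn_gt0// ltr0n.
have rl : sqrtc r ^+ 2 = r := sqr_sqrtc r.
have r0 : r != 0.
  apply: contraTneq hr => ->; by rewrite subr0 cmodX -leNgt.
exists (sqrtc r).
  apply: strip_poly_root_eigenvalue => //; last by rewrite rl.
  by rewrite sqrtc_eq0.
rewrite -!cmodX rl ltrBlDr -ltrBlDl.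
by apply: le_lt_trans hr; rewrite -(cmodN r) cmod_triangle_sub.
Unshelve. all: by end_near. Qed.

End StripMatrix.

Section StripRadius.
Variable R : realType.
Local Notation C := R[i].

(** Only b ^ 2 enters the spectrum: changing the sign of every [p i] changes the
    sign of [b].  This exchanges the edges a + b and a - b. *)
Lemma eigenvalue_strip_opp (a b : C) n l :
  eigenvalue (strip_mx a (- b) n) l -> eigenvalue (strip_mx a b n) l.
Proof.
move=> /eigenvalue_stripP[p [q [qn [i lin nz] e]]]; apply/eigenvalue_stripP.
exists (fun j => - p j), q; split=> //; first by exists i => //; rewrite oppr_eq0.
have s j : prev_entry (fun j => - p j) j = - prev_entry p j by case: j => //=; rewrite oppr0.
move=> j ljn; have [e1 e2] := e j ljn; split.
  by rewrite s mulrN e1; ring.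
by rewrite e2; ring.
Qed.

Lemma eigenvalue_strip_near_max (a b : C) (eps : R) : a != 0 -> b != 0 -> 0 < eps ->
  \forall n \near \oo, exists2 l, eigenvalue (strip_mx a b n) l &
    Num.max (cmod (a + b)) (cmod (a - b)) ^+ 2 - eps < cmod l ^+ 2.
Proof.
move=> a0 b0 e0; case: (leP (cmod (a - b)) (cmod (a + b))) => h.
  apply: eigenvalue_strip_near => //; apply: contra b0 => /eqP ab.
  move: h; rewrite ab cmod0 => h.
  have : cmod (a - b) == 0 by rewrite eq_le h cmod_ge0.
  rewrite cmod_eq0 => /eqP ab'.
  have : 2 * b = (a + b) - (a - b) by ring.
  rewrite ab ab' subrr.
  by move/eqP; rewrite mulf_eq0 pnatr_eq0.
have ab : a - b != 0.
  by rewrite -cmod_gt0 (le_lt_trans _ h)// cmod_ge0.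
have nb : - b != 0 by rewrite oppr_eq0.
have near_l := eigenvalue_strip_near a0 nb ab e0.
apply: filterS near_l => n [l hl lt].
exists l; [exact: eigenvalue_strip_opp hl | exact: lt].
Qed.

(** The matrices are far from normal, so it is the explicit eigenvalues near the
    larger edge that match the norm bound [eigenvalue_strip_le].  For b = 0 the
    matrices are nilpotent and the limit would be 0 instead. *)
Lemma cvg_spectral_radius_strip (a b : C) : a != 0 -> b != 0 ->
  spectral_radius (block_tridiag_toeplitz N (mx2 0 0 0 a) (mx2 0 b b 0)
                                            (mx2 a 0 0 0)) @[N --> \oo]
  --> Num.max (cmod (a + b)) (cmod (a - b)).
Proof.
move=> a0 b0; set M := Num.max _ _.
have M0 : 0 <= M by rewrite le_max cmod_ge0.
rewrite -cvg_shiftS; apply/cvgrPdist_le => e e0.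
pose d := Num.min e 1; have d0 : 0 < d by rewrite lt_min e0 ltr01.
have de : d <= e by rewrite ge_min lexx.
have d1 : d <= 1 by rewrite ge_min lexx orbT.
(* Eigenvalues are located through their squares: a tolerance of d ^ 2 there
   gives d on the modulus, as (M - d) ^ 2 <= M ^ 2 - d ^ 2 when d <= M. *)
have near_l := eigenvalue_strip_near_max a0 b0 (exprn_gt0 2 d0).
apply: filterS near_l => n [l hl lt].
rewrite -/(strip_mx a b n).
have ub l' : eigenvalue (strip_mx a b n) l' -> cmod l' <= M.
  by apply: eigenvalue_strip_le; rewrite le_max lexx ?orbT.
have sup_le : spectral_radius (strip_mx a b n) <= M.
  apply: ge_sup; first by exists (cmod l); exists l.
  by move=> _ [l' hl' <-]; exact: ub.
have le_sup : cmod l <= spectral_radius (strip_mx a b n).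
  apply: ub_le_sup; last by exists l.
  by exists M => _ [l' hl' <-]; exact: ub.
rewrite ger0_norm ?subr_ge0// lerBlDr -lerBlDl (le_trans _ le_sup)//.
apply: (@le_trans _ _ (M - d)); first by rewrite lerB.
rewrite -/M in lt.
have [Md|dM] := leP M d.
  by rewrite (le_trans _ (cmod_ge0 _))// subr_le0.
rewrite -(@ler_pXn2r _ 2%N) ?nnegrE ?subr_ge0 ?cmod_ge0 ?(ltW dM)//.
apply: le_trans (ltW lt).
have : 0 <= d * (M - d) by apply: mulr_ge0; rewrite ?subr_ge0 ltW.
move=> h; rewrite -subr_ge0; have -> : M ^+ 2 - d ^+ 2 - (M - d) ^+ 2 = 2 * (d * (M - d)) by ring.
by rewrite mulr_ge0.
Qed.

End StripRadius.

(** * A real inequality between energies of a mode *)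

Section RealBounds.
Variable R : realType.
Implicit Types x : R.

Lemma norm_sin_le x : 0 <= x -> `|sin x| <= x.
Proof.
move=> x0.
have [c _ e] : exists2 c, c \in `[0, x]%R & sin x - sin 0 = cos c * (x - 0).
  apply: MVT_segment => //.
  by apply: continuous_subspaceT => y; exact: continuous_sin.
rewrite sin0 !subr0 in e; rewrite e normrM (ger0_norm x0) ler_piMl//.
by rewrite ler_norml cos_geN1 cos_le1.
Qed.

Lemma expR_sub_gt x : 0 < x -> 2 * x < expR x - expR (- x).
Proof.
move=> x0.
have dn t : is_derive (t : R) (1 : R) (fun y : R => expR (- y)) (- expR (- t)).
  have := @is_derive1_comp R expR -%R t _ _ (is_derive_expR _) (is_deriveNid t 1).
  by rewrite mulrN1.
have df t : is_derive (t : R) (1 : R) (fun y : R => expR y - expR (- y)) (expR t + expR (- t)).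
  by have := is_deriveB (is_derive_expR t) (dn t); rewrite opprK.
have cf : {within `[0, x], continuous (fun y : R => expR y - expR (- y))}.
  apply: continuous_subspaceT => y.
  by apply: differentiable_continuous; apply/derivable1_diffP; have [] := df y.
have [c] := MVT x0 (fun t _ => df t) cf.
rewrite in_itv/= => /andP[c0 _]; rewrite /= oppr0 subrr subr0 addr0 => ->.
rewrite ltr_pM2r//.
have := expR_gt1Dx (lt0r_neq0 c0).
have nc : - c != 0 by rewrite oppr_eq0 gt_eqF.
have := expR_gt1Dx nc; lra.
Qed.

Lemma expR_add_ge x : 2 <= expR x + expR (- x).
Proof. by have := expR_ge1Dx x; have := expR_ge1Dx (- x); lra. Qed.

(** The squared modulus of [edge_mode] below, for z = c + i d, alpha = sigma + i
    and eps = 1 or -1. *)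
Definition edge_energy (c d sigma eps x : R) : R :=
  ((c + sigma) ^+ 2 + (d + 1) ^+ 2) * expR (2 * c * x)
  + ((c - sigma) ^+ 2 + (d - 1) ^+ 2) * expR (- (2 * c * x))
  - 2 * eps * ((c ^+ 2 + d ^+ 2 - sigma ^+ 2 - 1) * cos (2 * d * x)
               + 2 * (d * sigma - c) * sin (2 * d * x)).

(** With h and delta the half length L / 2 and the overlap parameter, the
    difference of the two energies is H * U + 4 eps sin(2 d h) * V, where
    H = 2 sinh(2 c h) exceeds 4 c h while |sin(2 d h)| <= 2 d h.  So
    2 d |V| <= c U is enough.  The bounds |sin y| <= y and
    e ^ x - e ^ - x >= 2 x reduce that to the two algebraic inequalities
    [hB] and [hA]; the condition sigma >= 1 is what makes [hA] true. *)
Lemma edge_energy_lt (c d sigma eps delta h : R) :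
  0 < c -> 0 < d -> 1 <= sigma -> 2 * c * d = sigma -> d ^+ 2 - c ^+ 2 <= 1 ->
  eps ^+ 2 = 1 -> 0 < delta -> 0 < h ->
  edge_energy c d sigma eps (delta - h) < edge_energy c d sigma eps (delta + h).
Proof.
move=> c0 d0 s1 cd dc eps2 de0 h0.
have s0 : 0 < sigma by exact: lt_le_trans s1.
set A := c ^+ 2 + d ^+ 2 - sigma ^+ 2 - 1.
set N := c ^+ 2 + d ^+ 2 + sigma ^+ 2 + 1.
set B := d * sigma - c.
set Q := c * sigma + d.
have Q0 : 0 < Q by rewrite addr_gt0// mulr_gt0.
have N0 : 0 < N by rewrite /N !addr_gt0// exprn_gt0.
have cdp : 0 < c * d by rewrite mulr_gt0.
have hB : d * `|B| <= c * Q.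
  rewrite -(ger0_norm (ltW d0)) -normrM ler_norml; apply/andP; split.
    rewrite -subr_ge0 (_ : _ - _ = (c ^+ 2 + d ^+ 2) * sigma); last by rewrite /Q /B; ring.
    by rewrite mulr_ge0 ?ltW// addr_gt0// exprn_gt0.
  rewrite -subr_ge0
    (_ : _ - _ = (1 - (d ^+ 2 - c ^+ 2)) * sigma + (2 * c * d - sigma)); last first.
    by rewrite /Q /B; ring.
  by rewrite cd subrr addr0 mulr_ge0 ?subr_ge0// ltW.
have hA : d ^+ 2 * `|A| <= c ^+ 2 * N.
  rewrite -(ger0_norm (sqr_ge0 d)) -normrM ler_norml; apply/andP; split.
    rewrite -subr_ge0
      (_ : _ - _ = (c ^+ 2 + d ^+ 2) ^+ 2 - (d ^+ 2 - c ^+ 2) * (1 + sigma ^+ 2)); last first.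
      by rewrite /A /N; ring.
    have -> : (c ^+ 2 + d ^+ 2) ^+ 2 = (d ^+ 2 - c ^+ 2) ^+ 2 + sigma ^+ 2.
      by rewrite -cd; ring.
    have : 1 <= sigma ^+ 2 by rewrite exprn_ege1.
    set D := d ^+ 2 - c ^+ 2 in dc *; set S := sigma ^+ 2 => S1.
    have -> : D ^+ 2 + S - D * (1 + S) = (S - D) * (1 - D) by ring.
    by rewrite mulr_ge0 ?subr_ge0// (le_trans dc).
  rewrite -subr_ge0
    (_ : _ - _ = (c ^+ 2 + d ^+ 2) * (1 + sigma ^+ 2 - (d ^+ 2 - c ^+ 2))); last first.
    by rewrite /A /N; ring.
  apply: mulr_ge0; first by rewrite addr_ge0 ?sqr_ge0.
  by rewrite subr_ge0 (le_trans dc)// lerDl sqr_ge0.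
pose x := 2 * c * delta; pose y := 2 * d * delta.
pose H := expR (2 * c * h) - expR (- (2 * c * h)).
pose U := N * (expR x - expR (- x)) + 2 * Q * (expR x + expR (- x)).
pose V := A * sin y - 2 * B * cos y.
have -> : edge_energy c d sigma eps (delta + h) =
    edge_energy c d sigma eps (delta - h) + (H * U + 4 * (eps * sin (2 * d * h) * V)).
  rewrite /edge_energy (mulrDr (2 * c)) (mulrDr (2 * d)) (mulrBr (2 * c)) (mulrBr (2 * d)).
  rewrite -/x -/y !opprD !expRD opprK cosD sinD cosB sinB /H /U /V /N /Q /A /B.
  by ring.
rewrite ltrDl.
have hV : 2 * d * `|V| <= c * U.
  have y0 : 0 <= y by rewrite !mulr_ge0// ltW.
  have V1 : `|V| <= `|A| * y + 2 * `|B|.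
    rewrite (le_trans (ler_normB _ _))// lerD//.
      by rewrite normrM ler_wpM2l// norm_sin_le.
    rewrite !normrM (ger0_norm (ler0n _ 2)) ler_piMr ?mulr_ge0//.
    by rewrite ler_norml cos_geN1 cos_le1.
  have U1 : N * (2 * x) + 4 * Q <= U.
    rewrite lerD//.
      by rewrite ler_wpM2l ?ltW// expR_sub_gt// !mulr_gt0.
    have := ler_wpM2l (ltW Q0) (expR_add_ge x); lra.
  apply: (@le_trans _ _ (2 * d * (`|A| * y + 2 * `|B|))).
    by rewrite ler_wpM2l// mulr_ge0// ltW.
  apply: (@le_trans _ _ (c * (N * (2 * x) + 4 * Q))); last by rewrite ler_wpM2l// ltW.
  have k1 : 4 * delta * (d ^+ 2 * `|A|) <= 4 * delta * (c ^+ 2 * N).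
    by rewrite ler_wpM2l// mulr_ge0// ltW.
  rewrite -subr_ge0.
  have -> : c * (N * (2 * x) + 4 * Q) - 2 * d * (`|A| * y + 2 * `|B|) =
    (4 * delta * (c ^+ 2 * N) - 4 * delta * (d ^+ 2 * `|A|)) + 4 * (c * Q - d * `|B|).
    by rewrite /x /y; ring.
  by rewrite addr_ge0// ?mulr_ge0// subr_ge0.
have U0 : 0 < U.
  rewrite ltr_wpDl//.
    rewrite mulr_ge0 ?ltW//; apply: le_lt_trans (expR_sub_gt _);
      by rewrite ?mulr_ge0 ?mulr_gt0 ?ltW.
  by rewrite mulr_gt0 ?mulr_gt0// (lt_le_trans _ (expR_add_ge x)).
have hH : 2 * (2 * c * h) * U < H * U.
  by rewrite ltr_pM2r// expR_sub_gt// !mulr_gt0.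
have hs : `|eps * sin (2 * d * h) * V| <= 2 * d * h * `|V|.
  rewrite !normrM; have -> : `|eps| = 1.
    by apply/eqP; rewrite -sqrp_eq1// -normrX eps2 normr1.
  by rewrite mul1r ler_wpM2r// norm_sin_le// !mulr_ge0// ltW.
move: hs; rewrite ler_norml => /andP[hs _].
have k2 : 2 * h * (2 * d * `|V|) <= 2 * h * (c * U) by rewrite ler_wpM2l// mulr_ge0// ltW.
lra.
Qed.

End RealBounds.

(** * Matrix entries in terms of even and odd modes *)

Section ComplexExp.
Local Open Scope complex_scope.
Variable R : realType.
Implicit Types z w : R[i].

Lemma cexpD z w : cexp (z + w) = cexp z * cexp w.
Proof.
case: z => x y; case: w => u v; rewrite /cexp /= expRD cosD sinD.
by apply/eqP; rewrite eq_complex /=; apply/andP; split; apply/eqP; ring.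
Qed.

Lemma cexp0 : cexp (0 : R[i]) = 1.
Proof. by rewrite /cexp /= expR0 cos0 sin0 mulr1 mulr0. Qed.

Lemma cmod_cexp z : cmod (cexp z) = expR (complex.Re z).
Proof.
apply/eqP; rewrite -(@eqrXn2 _ 2%N) ?cmod_ge0 ?expR_ge0// cmod_sqr /cexp /=.
by rewrite !exprMn -mulrDr cos2Dsin2 mulr1.
Qed.

Lemma cexp_neq0 z : cexp z != 0.
Proof. by rewrite -cmod_gt0 cmod_cexp expR_gt0. Qed.

Lemma cexpN z : cexp (- z) = (cexp z)^-1.
Proof.
apply: (mulfI (cexp_neq0 z)).
by rewrite -cexpD subrr cexp0 mulfV// cexp_neq0.
Qed.

Lemma Re_mulRC z (x : R) : complex.Re (z * x%:C) = complex.Re z * x.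
Proof. by case: z => u v /=; rewrite mulr0 subr0. Qed.

End ComplexExp.

Section EdgeMode.
Local Open Scope complex_scope.
Variable R : realType.
Local Notation C := R[i].

(** The two values [eps = 1] and [eps = -1] give the functions
    2 (z sinh (z x) + alpha cosh (z x)) and 2 (z cosh (z x) + alpha sinh (z x)),
    the impedance data produced by the solutions that are even and odd about
    the centre of a subdomain. *)
Definition edge_mode (z al eps : C) (x : R) : C :=
  (z + al) * cexp (z * x%:C) - eps * ((z - al) * cexp (- z * x%:C)).

(** The exponential factors enhance the larger of the two moduli. *)
Lemma exp_balance_neq0 (p q w : C) :
  p != 0 -> cmod q <= cmod p -> 0 < complex.Re w ->
  p * cexp w - q * cexp (- w) != 0.
Proof.
move=> p0 qp w0; rewrite -cmod_gt0.
apply: lt_le_trans (cmod_triangle_sub _ _).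
rewrite cmodN !cmodM !cmod_cexp subr_gt0.
have -> : complex.Re (- w) = - complex.Re w by case: w {w0}.
apply: (@le_lt_trans _ _ (cmod p * expR (- complex.Re w))).
  by rewrite ler_wpM2r ?expR_ge0.
by rewrite ltr_pM2l ?cmod_gt0// ltr_expR gtrN.
Qed.

Lemma edge_mode_neq0 (z al eps : C) (x : R) :
  cmod eps = 1 -> z + al != 0 -> cmod (z - al) <= cmod (z + al) ->
  0 < complex.Re z -> 0 < x -> edge_mode z al eps x != 0.
Proof.
move=> eps1 p0 lt z0 x0; rewrite /edge_mode mulrA mulNr.
by apply: exp_balance_neq0; rewrite ?cmodM ?eps1 ?mul1r// Re_mulRC mulr_gt0.
Qed.

Variables (k sigma L delta kt : R).
Local Notation z := (zeta k sigma kt).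
Local Notation al := (alpha k sigma).

(** With p = (z + alpha) e ^ (z (delta + L / 2)) and q = (z - alpha)
    e ^ (- z (delta + L / 2)), the common denominator of a and b factors as
    (p - q) (p + q), and a + eps b loses one of the two factors. *)
Lemma coef_edge (eps : C) :
  eps ^+ 2 = 1 -> coef_den k sigma L delta kt != 0 ->
  edge_mode z al eps (delta + L / 2) != 0 ->
  coef_a k sigma L delta kt + eps * coef_b k sigma L delta kt
  = edge_mode z al eps (delta - L / 2) / edge_mode z al eps (delta + L / 2).
Proof.
move=> eps2 den0 F0; rewrite /coef_a /coef_b.
have u0 := cexp_neq0 (z * delta%:C); have v0 := cexp_neq0 (z * (L / 2)%:C).
set u := cexp _ in u0; set v := cexp _ in v0.
have e1 : cexp (z * (2 * delta + L)%:C) = u ^+ 2 * v ^+ 2.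
  rewrite !expr2 -!cexpD; congr cexp; rewrite -!mulrDr -!rmorphD /=; congr (_ * _%:C).
  by field.
have e2 : cexp (2 * z * delta%:C) = u ^+ 2.
  by rewrite expr2 -cexpD; congr cexp; ring.
have e3 : cexp (z * L%:C) = v ^+ 2.
  rewrite !expr2 -!cexpD; congr cexp; rewrite -!mulrDr -!rmorphD /=; congr (_ * _%:C).
  by field.
have e4 : cexp (z * (delta + L / 2)%:C) = u * v.
  by rewrite -cexpD rmorphD mulrDr.
have e5 : cexp (z * (delta - L / 2)%:C) = u / v.
  by rewrite -cexpN -cexpD rmorphB mulrBr.
have e6 : - 2 * z * delta%:C = - (2 * z * delta%:C) by ring.
move: den0 F0; rewrite /edge_mode /coef_den e6 !mulNr !cexpN e1 e2 e3 e4 e5.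
have : (eps - 1) * (eps + 1) = 0 by rewrite -subr_sqr eps2; ring.
move/eqP; rewrite mulf_eq0 subr_eq0 addr_eq0 => /orP[]/eqP-> den0 F0; field.
all: rewrite u0 v0 /=; apply/andP; split;
  [apply: contraNneq F0 => h | apply: contraNneq den0 => h].
- have -> : (z + al) * (u * v) - 1 * ((z - al) / (u * v)) =
    ((z + al) * (u * v) * (u * v) - (z - al)) / (u * v) by field; rewrite u0 v0.
  by rewrite h mul0r.
- have -> : (z + al) ^+ 2 * (u ^+ 2 * v ^+ 2) - (z - al) ^+ 2 / (u ^+ 2 * v ^+ 2) =
    (((z + al) * (u * v) * (u * v)) ^+ 2 - (z - al) ^+ 2) / (u ^+ 2 * v ^+ 2).
    by field; rewrite u0 v0.
  by rewrite h mul0r.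
- have -> : (z + al) * (u * v) - -1 * ((z - al) / (u * v)) =
    ((z + al) * (u * v) * (u * v) - -1 * (z - al)) / (u * v) by field; rewrite u0 v0.
  by rewrite h mul0r.
- have -> : (z + al) ^+ 2 * (u ^+ 2 * v ^+ 2) - (z - al) ^+ 2 / (u ^+ 2 * v ^+ 2) =
    (((z + al) * (u * v) * (u * v)) ^+ 2 - (z - al) ^+ 2) / (u ^+ 2 * v ^+ 2).
    by field; rewrite u0 v0.
  by rewrite h mul0r.
Qed.

Hypotheses (Rez : 0 < complex.Re z) (p0 : z + al != 0)
  (qp : cmod (z - al) <= cmod (z + al)) (L0 : 0 < L) (delta0 : 0 < delta).

Let p2 : (z + al) ^+ 2 != 0. Proof. by rewrite expf_neq0. Qed.

Let qp2 : cmod ((z - al) ^+ 2) <= cmod ((z + al) ^+ 2).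
Proof. by rewrite !cmodX lerXn2r ?nnegrE ?cmod_ge0. Qed.

Lemma coef_den_neq0 : coef_den k sigma L delta kt != 0.
Proof.
rewrite /coef_den mulNr; apply: exp_balance_neq0 => //.
by rewrite Re_mulRC mulr_gt0// addr_gt0// mulr_gt0.
Qed.

Lemma coef_a_neq0 : coef_a k sigma L delta kt != 0.
Proof.
rewrite /coef_a mulf_neq0 ?invr_eq0 ?coef_den_neq0//.
have -> : - 2 * z * delta%:C = - (2 * z * delta%:C) by ring.
apply: exp_balance_neq0 => //.
have -> : 2 * z * delta%:C = z * (2 * delta)%:C by rewrite rmorphM rmorph_nat; ring.
by rewrite Re_mulRC mulr_gt0// mulr_gt0.
Qed.

Lemma coef_b_neq0 : z ^+ 2 != al ^+ 2 -> coef_b k sigma L delta kt != 0.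
Proof.
move=> zal; rewrite /coef_b mulf_neq0 ?invr_eq0 ?coef_den_neq0// oppr_eq0.
rewrite mulf_neq0 ?subr_eq0//.
have := @exp_balance_neq0 1 1 (z * L%:C) (oner_neq0 _) (lexx _).
by rewrite !mul1r mulNr subr_eq0; apply; rewrite Re_mulRC mulr_gt0.
Qed.

Lemma cmod_coef_edge (eps : C) : eps ^+ 2 = 1 ->
  cmod (coef_a k sigma L delta kt + eps * coef_b k sigma L delta kt)
  = cmod (edge_mode z al eps (delta - L / 2))
    / cmod (edge_mode z al eps (delta + L / 2)).
Proof.
move=> eps2; have eps1 : cmod eps = 1.
  apply/eqP; rewrite -(@eqrXn2 _ 2%N) ?cmod_ge0// -cmodX eps2.
  by rewrite cmod1 expr1n.
rewrite coef_edge ?coef_den_neq0// ?cmodM ?cmodV//.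
by rewrite edge_mode_neq0// addr_gt0// divr_gt0.
Qed.

(** Numerator and denominator of [coef_edge] are compared with the single growing
    exponential E = |z + alpha| e ^ (c (delta + L / 2)): relative to E the
    numerator is at most X + Y and the denominator at least 1 - X Y. *)
Lemma cmod_coef_edge_le (eps : C) (X Y : R) : eps ^+ 2 = 1 ->
  expR (- (complex.Re z * L)) <= X -> expR (- (2 * complex.Re z * delta)) <= Y ->
  X * Y < 1 ->
  cmod (coef_a k sigma L delta kt + eps * coef_b k sigma L delta kt)
  <= (X + Y) / (1 - X * Y).
Proof.
move=> eps2 hX hY XY; have eps1 : cmod eps = 1.
  apply/eqP; rewrite -(@eqrXn2 _ 2%N) ?cmod_ge0// -cmodX eps2.
  by rewrite cmod1 expr1n.
have X0 : 0 <= X := le_trans (expR_ge0 _) hX.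
have Y0 : 0 <= Y := le_trans (expR_ge0 _) hY.
have F0 : 0 < cmod (edge_mode z al eps (delta + L / 2)).
  by rewrite cmod_gt0 edge_mode_neq0// addr_gt0// divr_gt0.
rewrite cmod_coef_edge// ler_pdivrMr// mulrAC ler_pdivlMr ?subr_gt0//.
set c := complex.Re z in hX hY.
pose P := cmod (z + al).
pose E := P * expR (c * (delta + L / 2)).
have E0 : 0 <= E by rewrite mulr_ge0 ?cmod_ge0 ?expR_ge0.
have ReN (x : R) : complex.Re (- z * x%:C) = - (c * x).
  by rewrite mulNr -Re_mulRC; case: (z * x%:C).
have upper : cmod (edge_mode z al eps (delta - L / 2)) <= E * (X + Y).
  rewrite /edge_mode; apply: le_trans (cmod_triangle _ _) _.
  rewrite cmodN !cmodM eps1 mul1r !cmod_cexp Re_mulRC ReN [leRHS]mulrDr lerD//.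
    apply: (@le_trans _ _ (E * expR (- (c * L)))); last by rewrite ler_wpM2l.
    rewrite /E -mulrA -expRD le_eqVlt; apply/orP; left; apply/eqP.
    by congr (_ * expR _); rewrite -/c; field.
  apply: (@le_trans _ _ (E * expR (- (2 * c * delta)))); last by rewrite ler_wpM2l.
  rewrite /E -mulrA -expRD (_ : c * (delta + L / 2) - 2 * c * delta = - (c * (delta - L / 2))).
    by rewrite ler_wpM2r ?expR_ge0.
  by field.
have lower : E * (1 - X * Y) <= cmod (edge_mode z al eps (delta + L / 2)).
  rewrite /edge_mode; apply: le_trans (cmod_triangle_sub _ _).
  rewrite cmodN !cmodM eps1 mul1r !cmod_cexp Re_mulRC ReN [leLHS]mulrBr mulr1 lerB//.
  apply: (@le_trans _ _ (E * (expR (- (c * L)) * expR (- (2 * c * delta))))).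
    rewrite /E -mulrA -!expRD (_ : c * (delta + L / 2) + _ = - (c * (delta + L / 2))).
      by rewrite ler_wpM2r ?expR_ge0.
    by field.
  by rewrite ler_wpM2l// ler_pM ?expR_ge0.
apply: (@le_trans _ _ (E * (X + Y) * (1 - X * Y))).
  by rewrite ler_wpM2r// subr_ge0 ltW.
by rewrite mulrAC mulrC ler_wpM2l// addr_ge0.
Qed.

End EdgeMode.

(** * Scaling by the wave number *)

Section Scaling.
Local Open Scope complex_scope.
Variable R : realType.
Variables (k sigma0 L0 delta0 kt : R).
Hypothesis k0 : 0 < k.

Let kC0 : k%:C != 0 :> R[i].
Proof. by rewrite (inj_eq (@complexI _) k 0) gt_eqF. Qed.

(** Positive scaling commutes with the principal branch. *)
Lemma sqrtc_scale (w : R[i]) : sqrtc ((k ^+ 2)%:C * w) = k%:C * sqrtc w.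
Proof.
case: w => x y.
have k2 : 0 < k ^+ 2 by rewrite exprn_gt0.
have -> : (k ^+ 2)%:C * (x +i* y) = (k ^+ 2 * x) +i* (k ^+ 2 * y).
  by apply/eqP; rewrite eq_complex /= !mul0r subr0 addr0 !eqxx.
rewrite /sqrtc mulf_eq0 (gt_eqF k2) /= sgrM (gtr0_sg k2) mul1r.
have -> : Num.sqrt ((k ^+ 2 * x) ^+ 2 + (k ^+ 2 * y) ^+ 2) =
    k ^+ 2 * Num.sqrt (x ^+ 2 + y ^+ 2).
  rewrite !exprMn -mulrDr sqrtrM ?sqr_ge0//.
  by rewrite sqrtr_sqr ger0_norm// ltW.
rewrite -mulrDr -mulrBr -!(mulrA (k ^+ 2)) !(sqrtrM _ (sqr_ge0 k)).
rewrite sqrtr_sqr (ger0_norm (ltW k0)).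
by apply/eqP; rewrite eq_complex /= !mul0r subr0 addr0 mulrCA !eqxx.
Qed.

(** With sigma, L, delta scaled with k, every quantity is homogeneous in k: only
    the ratio kt / k of the Fourier number to the wave number remains. *)
Lemma zeta_scale : zeta k (sigma0 * k) kt = k%:C * zeta 1 sigma0 (kt / k).
Proof.
rewrite /zeta -sqrtc_scale; congr sqrtc.
rewrite !(rmorphXn (real_complex R)) !(rmorphM (real_complex R)) fmorphV rmorph1.
by field.
Qed.

Lemma alpha_scale : alpha k (sigma0 * k) = k%:C * alpha 1 sigma0.
Proof. by rewrite /alpha rmorphM; ring. Qed.

Let kK (u : R[i]) (x : R) : k%:C * u * (x * k^-1)%:C = u * x%:C.
Proof.
by rewrite rmorphM fmorphV; field.
Qed.

Lemma coef_den_scale :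
  coef_den k (sigma0 * k) (L0 * k^-1) (delta0 * k^-1) kt
  = (k ^+ 2)%:C * coef_den 1 sigma0 L0 delta0 (kt / k).
Proof.
rewrite /coef_den zeta_scale alpha_scale !mulNr.
have -> : 2 * (delta0 * k^-1) + L0 * k^-1 = (2 * delta0 + L0) * k^-1 by ring.
by rewrite kK rmorphXn; ring.
Qed.

Let den_ratio (x y : R[i]) : (k ^+ 2)%:C * x / ((k ^+ 2)%:C * y) = x / y.
Proof. by rewrite -mulf_div mulfV ?mul1r// rmorphXn expf_neq0. Qed.

Lemma coef_a_scale :
  coef_a k (sigma0 * k) (L0 * k^-1) (delta0 * k^-1) kt
  = coef_a 1 sigma0 L0 delta0 (kt / k).
Proof.
rewrite /coef_a coef_den_scale zeta_scale alpha_scale.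
rewrite (mulrCA _ k%:C) (mulrCA _ k%:C) !kK.
rewrite -[RHS]den_ratio; congr (_ / _); rewrite rmorphXn; ring.
Qed.

Lemma coef_b_scale :
  coef_b k (sigma0 * k) (L0 * k^-1) (delta0 * k^-1) kt
  = coef_b 1 sigma0 L0 delta0 (kt / k).
Proof.
rewrite /coef_b coef_den_scale zeta_scale alpha_scale !mulNr !kK.
rewrite -[in RHS]den_ratio; congr (- (_ / _)); rewrite rmorphXn; ring.
Qed.

Lemma T1d_scale N :
  T1d k (sigma0 * k) (L0 * k^-1) (delta0 * k^-1) N kt
  = T1d 1 sigma0 L0 delta0 N (kt / k).
Proof. by rewrite /T1d coef_a_scale coef_b_scale. Qed.

End Scaling.

(** * The symbol at unit wave number *)

Section UnitWaveNumber.
Local Open Scope complex_scope.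
Variable R : realType.
Variable sigma : R.
Hypothesis sigma_gt0 : 0 < sigma.
Implicit Types s : R.

Local Notation decay s := (complex.Re (zeta 1 sigma s)).
Local Notation freq s := (complex.Im (zeta 1 sigma s)).

Lemma zeta1E s : zeta 1 sigma s = sqrtc ((s ^+ 2 - 1) +i* sigma).
Proof.
rewrite /zeta mul1r expr1n; congr sqrtc.
by apply/eqP; rewrite eq_complex /=; apply/andP; split; apply/eqP; ring.
Qed.

Let modulus s : R := Num.sqrt ((s ^+ 2 - 1) ^+ 2 + sigma ^+ 2).

Lemma Re_zeta1 s : complex.Re (zeta 1 sigma s) =
  Num.sqrt ((Num.sqrt ((s ^+ 2 - 1) ^+ 2 + sigma ^+ 2) + (s ^+ 2 - 1)) / 2).
Proof. by rewrite zeta1E. Qed.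

Lemma Im_zeta1 s : complex.Im (zeta 1 sigma s) =
  Num.sqrt ((Num.sqrt ((s ^+ 2 - 1) ^+ 2 + sigma ^+ 2) - (s ^+ 2 - 1)) / 2).
Proof. by rewrite zeta1E /= gt_eqF// gtr0_sg// mul1r. Qed.

Let abs_lt s : `|s ^+ 2 - 1| < modulus s.
Proof.
rewrite -sqrtr_sqr ltr_sqrt ?ltrDl ?exprn_gt0//.
by rewrite ltr_wpDl ?sqr_ge0// exprn_gt0.
Qed.

Lemma Re_zeta1_gt0 s : 0 < complex.Re (zeta 1 sigma s).
Proof.
rewrite Re_zeta1 sqrtr_gt0 divr_gt0// -(subrr (s ^+ 2 - 1)) addrC ltrD2r.
by have := abs_lt s; rewrite ltr_norml => /andP[+ _]; rewrite ltrNl.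
Qed.

Lemma Im_zeta1_gt0 s : 0 < complex.Im (zeta 1 sigma s).
Proof.
by rewrite Im_zeta1 sqrtr_gt0 divr_gt0// subr_gt0 (le_lt_trans (ler_norm _)).
Qed.

Lemma zeta1_sqr s : (zeta 1 sigma s) ^+ 2 = (s ^+ 2 - 1) +i* sigma.
Proof. by rewrite zeta1E sqr_sqrtc. Qed.

Lemma zeta1_sqr_Re s : decay s ^+ 2 - freq s ^+ 2 = s ^+ 2 - 1.
Proof.
have := congr1 (@complex.Re R) (zeta1_sqr s).
by case: (zeta 1 sigma s) => u v /=; rewrite !expr2.
Qed.

Lemma zeta1_sqr_Im s : 2 * decay s * freq s = sigma.
Proof.
have := congr1 (@complex.Im R) (zeta1_sqr s).
case: (zeta 1 sigma s) => u v /= <-.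
by rewrite -mulrA mulr2n mulrDl mul1r [v * u]mulrC.
Qed.

Lemma alpha1E : alpha 1 sigma = sigma +i* 1.
Proof.
by apply/eqP; rewrite eq_complex /=; apply/andP; split; apply/eqP; ring.
Qed.

(** Both z and alpha lie in the open first quadrant; this is also why
    |z - alpha| <= |z + alpha| below. *)
Lemma zeta1_alpha1_neq0 s : zeta 1 sigma s + alpha 1 sigma != 0.
Proof.
rewrite alpha1E; apply: contraTneq (Re_zeta1_gt0 s) => /(congr1 (@complex.Re R)).
case: (zeta 1 sigma s) => u v /= h; rewrite -leNgt; move: sigma_gt0; lra.
Qed.

Lemma cmod_zeta1_sub_alpha1 s :
  cmod (zeta 1 sigma s - alpha 1 sigma) <= cmod (zeta 1 sigma s + alpha 1 sigma).
Proof.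
rewrite -(@ler_pXn2r _ 2%N) ?nnegrE ?cmod_ge0// !cmod_sqr alpha1E.
move: (Re_zeta1_gt0 s) (Im_zeta1_gt0 s); case: (zeta 1 sigma s) => u v /= u0 v0.
have := mulr_gt0 u0 sigma_gt0; rewrite -subr_ge0.
have -> : (u + sigma) ^+ 2 + (v + 1) ^+ 2 - ((u - sigma) ^+ 2 + (v - 1) ^+ 2) =
  4 * (u * sigma) + 4 * v by ring.
lra.
Qed.

(** The imaginary parts are sigma and 2 sigma. *)
Lemma zeta1_sqr_neq_alpha1 s : zeta 1 sigma s ^+ 2 != alpha 1 sigma ^+ 2.
Proof.
rewrite zeta1_sqr alpha1E; apply/negP => /eqP/(congr1 (@complex.Im R)) /=.
move=> h; move: sigma_gt0; rewrite {1}h; lra.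
Qed.

Lemma cmod_edge_mode (eps x : R) s : eps ^+ 2 = 1 ->
  cmod (edge_mode (zeta 1 sigma s) (alpha 1 sigma) eps%:C x) ^+ 2
  = edge_energy (decay s) (freq s) sigma eps x.
Proof.
move=> eps2; rewrite cmod_sqr /edge_mode /edge_energy alpha1E mulNr cexpN.
rewrite -cexpN /cexp; case: (zeta 1 sigma s) => c d /=.
rewrite !(mulr0, mul0r, subr0, add0r, addr0) sinN cosN.
rewrite (_ : 2 * c * x = c * x + c * x); last by ring.
rewrite (_ : 2 * d * x = d * x + d * x); last by ring.
rewrite cosD sinD opprD !expRD.
set E := expR (c * x); set E' := expR (- (c * x)).
set C := cos (d * x); set S := sin (d * x).
have EE : E * E' = 1 by rewrite /E /E' -expRD subrr expR0.
have CS : C ^+ 2 + S ^+ 2 = 1 by exact: cos2Dsin2.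
transitivity (((c + sigma) ^+ 2 + (d + 1) ^+ 2) * (E * E) * (C ^+ 2 + S ^+ 2)
  + eps ^+ 2 * ((c - sigma) ^+ 2 + (d - 1) ^+ 2) * (E' * E') * (C ^+ 2 + S ^+ 2)
  - 2 * eps * (E * E') * ((c ^+ 2 + d ^+ 2 - sigma ^+ 2 - 1) * (C * C - S * S)
     + 2 * (d * sigma - c) * (S * C + C * S))).
  by ring.
by rewrite EE CS eps2; ring.
Qed.

End UnitWaveNumber.

(** * The limiting convergence rate as a function of s *)

Section Rate.
Local Open Scope complex_scope.
Variable R : realType.
Variables sigma L delta : R.
Hypotheses (sigma_gt0 : 0 < sigma) (L_gt0 : 0 < L) (delta_gt0 : 0 < delta).
Implicit Types s : R.

(** The value of [R1d] for unit wave number, extended from Fourier numbers to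
    all real [s]. *)
Definition rate s : R :=
  Num.max (cmod (coef_a 1 sigma L delta s + coef_b 1 sigma L delta s))
          (cmod (coef_a 1 sigma L delta s - coef_b 1 sigma L delta s)).

(** The square of the modulus of a + eps b, in terms of real functions only. *)
Definition edge_ratio (eps s : R) : R :=
  let c := complex.Re (zeta 1 sigma s) in
  let d := complex.Im (zeta 1 sigma s) in
  edge_energy c d sigma eps (delta - L / 2)
  / edge_energy c d sigma eps (delta + L / 2).

Lemma edge_energy_gt0 (eps s x : R) : eps ^+ 2 = 1 -> 0 < x ->
  0 < edge_energy (complex.Re (zeta 1 sigma s)) (complex.Im (zeta 1 sigma s))
        sigma eps x.
Proof.
move=> eps2 x0; rewrite -cmod_edge_mode// exprn_gt0// cmod_gt0.
apply: edge_mode_neq0; rewrite ?zeta1_alpha1_neq0 ?cmod_zeta1_sub_alpha1 ?Re_zeta1_gt0//.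
apply/eqP; rewrite -(@eqrXn2 _ 2%N) ?cmod_ge0// cmod_sqr /= expr0n addr0 eps2.
by rewrite expr1n.
Qed.

Lemma cmod_coef_edge_ratio (eps s : R) : eps ^+ 2 = 1 ->
  cmod (coef_a 1 sigma L delta s + eps%:C * coef_b 1 sigma L delta s)
  = Num.sqrt (edge_ratio eps s).
Proof.
move=> eps2.
rewrite cmod_coef_edge ?zeta1_alpha1_neq0 ?cmod_zeta1_sub_alpha1 ?Re_zeta1_gt0//; last first.
  by rewrite -(rmorphXn (real_complex R)) eps2.
rewrite /edge_ratio -!cmod_edge_mode// -expr_div_n sqrtr_sqr ger0_norm//.
by rewrite divr_ge0 ?cmod_ge0.
Qed.

Lemma rateE s :
  rate s = Num.max (Num.sqrt (edge_ratio 1 s)) (Num.sqrt (edge_ratio (- 1) s)).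
Proof.
rewrite -!cmod_coef_edge_ratio ?sqrrN ?expr1n// rmorphN rmorph1.
by rewrite mul1r mulN1r.
Qed.

(** Valid at s = 0 as well, which the compactness argument for the supremum
    needs: there d ^ 2 - c ^ 2 = 1 - s ^ 2 reaches its largest value 1. *)
Lemma rate_lt1 s : 1 <= sigma -> rate s < 1.
Proof.
move=> s1; have hh : 0 < L / 2 by rewrite divr_gt0.
have H eps : eps ^+ 2 = 1 -> Num.sqrt (edge_ratio eps s) < 1.
  move=> eps2; rewrite -[ltRHS]sqrtr1 ltr_sqrt// /edge_ratio ltr_pdivrMr ?mul1r.
    apply: edge_energy_lt; rewrite ?Re_zeta1_gt0 ?Im_zeta1_gt0 ?zeta1_sqr_Im//.
    by rewrite -opprB zeta1_sqr_Re// opprB gerBl sqr_ge0.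
  by rewrite edge_energy_gt0// addr_gt0.
by rewrite rateE gt_max !H// ?sqrrN expr1n.
Qed.

Lemma rate_le s (X Y : R) :
  expR (- (complex.Re (zeta 1 sigma s) * L)) <= X ->
  expR (- (2 * complex.Re (zeta 1 sigma s) * delta)) <= Y ->
  X * Y < 1 -> rate s <= (X + Y) / (1 - X * Y).
Proof.
move=> hX hY XY; rewrite /rate ge_max.
have H := cmod_coef_edge_le (Re_zeta1_gt0 sigma_gt0 s) (zeta1_alpha1_neq0 sigma_gt0 s)
  (cmod_zeta1_sub_alpha1 sigma_gt0 s) L_gt0 delta_gt0 _ hX hY XY.
apply/andP; split.
  by have := H 1; rewrite mul1r; apply; rewrite expr1n.
by have := H (-1); rewrite mulN1r; apply; rewrite sqrrN expr1n.
Qed.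

Lemma cvg_spectral_radius_T1d s :
  spectral_radius (T1d 1 sigma L delta N s) @[N --> \oo] --> rate s.
Proof.
apply: cvg_spectral_radius_strip.
  by apply: coef_a_neq0; rewrite ?zeta1_alpha1_neq0 ?cmod_zeta1_sub_alpha1 ?Re_zeta1_gt0.
by apply: coef_b_neq0; rewrite ?zeta1_alpha1_neq0 ?cmod_zeta1_sub_alpha1
  ?Re_zeta1_gt0 ?zeta1_sqr_neq_alpha1.
Qed.

Lemma continuous_Re_zeta1 : continuous (fun s => complex.Re (zeta 1 sigma s)).
Proof.
under eq_fun do rewrite Re_zeta1.
move=> s; apply: continuous_comp; last exact: sqrt_continuous.
have csq : (fun t : R => t ^+ 2 - 1) @ s --> s ^+ 2 - 1.
  by apply: cvgB; [exact: exprn_continuous | exact: cvg_cst].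
apply: cvgM; last exact: cvg_cst.
apply: cvgD => //.
apply: (@continuous_comp _ _ _
  (fun t : R => (t ^+ 2 - 1) ^+ 2 + sigma ^+ 2) Num.sqrt);
  last exact: sqrt_continuous.
apply: cvgD; last exact: cvg_cst.
apply: (@continuous_comp _ _ _ (fun t : R => t ^+ 2 - 1) (fun t => t ^+ 2)) => //.
exact: exprn_continuous.
Qed.

(** Continuity is inherited from the real part through 2 c d = sigma. *)
Lemma continuous_Im_zeta1 : continuous (fun s => complex.Im (zeta 1 sigma s)).
Proof.
have -> : (fun s => complex.Im (zeta 1 sigma s)) =
    (fun s => sigma / (2 * complex.Re (zeta 1 sigma s))).
  apply/funext => s; have := Re_zeta1_gt0 sigma_gt0 s => c0.
  by apply: (canRL (mulfK _)); rewrite ?mulf_neq0 ?gt_eqF// mulrC zeta1_sqr_Im.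
move=> s; apply: cvgM; first exact: cvg_cst.
apply: cvgV; first by rewrite mulf_neq0 ?gt_eqF ?Re_zeta1_gt0.
by apply: cvgM; [exact: cvg_cst | exact: continuous_Re_zeta1].
Qed.

Lemma continuous_edge_energy (eps x : R) : continuous (fun s =>
  edge_energy (complex.Re (zeta 1 sigma s)) (complex.Im (zeta 1 sigma s)) sigma eps x).
Proof.
move=> s; rewrite /edge_energy.
have hc := @continuous_Re_zeta1 s; have hd := @continuous_Im_zeta1 s.
set c := fun s => complex.Re (zeta 1 sigma s) in hc *.
set d := fun s => complex.Im (zeta 1 sigma s) in hd *.
have sq (f : R -> R) : f @ s --> f s -> (fun t => f t ^+ 2) @ s --> f s ^+ 2.
  by move=> hf; under eq_fun do rewrite expr2; rewrite expr2; exact: cvgM.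
have kk (f : R -> R) (k : R) : f @ s --> f s -> (fun t => k * f t) @ s --> k * f s.
  by move=> hf; apply: cvgM => //; exact: cvg_cst.
have comp (g f : R -> R) : continuous g -> f @ s --> f s -> (fun t => g (f t)) @ s --> g (f s).
  by move=> hg hf; apply: (@continuous_comp _ _ _ f g) => //; exact: hg.
have cst (k : R) : (fun=> k) @ s --> k by exact: cvg_cst.
have phase (f : R -> R) : f @ s --> f s -> (fun t => 2 * f t * x) @ s --> 2 * f s * x.
  by move=> hf; apply: cvgM => //; exact: kk.
apply: cvgB; [apply: cvgD; apply: cvgM|].
- by apply: cvgD; [apply: (sq (fun t => c t + sigma)) | apply: (sq (fun t => d t + 1))];
    apply: cvgD.
- by apply: (comp expR (fun t => 2 * c t * x)); [exact: continuous_expR | exact: phase].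
- by apply: cvgD; [apply: (sq (fun t => c t - sigma)) | apply: (sq (fun t => d t - 1))];
    apply: cvgB.
- apply: (comp expR (fun t => - (2 * c t * x))); first exact: continuous_expR.
  by apply: cvgN; exact: phase.
- apply: cvgM; first exact: cst.
  apply: cvgD; apply: cvgM.
  + by apply: cvgB => //; apply: cvgB => //; apply: cvgD; [exact: (sq c) | exact: (sq d)].
  + by apply: (comp cos (fun t => 2 * d t * x)); [exact: continuous_cos | exact: phase].
  + apply: cvgM; first exact: cst.
    by apply: cvgB => //; apply: cvgM.
  + by apply: (comp sin (fun t => 2 * d t * x)); [exact: continuous_sin | exact: phase].
Qed.

Lemma continuous_rate : continuous rate.
Proof.
have -> : rate =
    (fun s => Num.max (Num.sqrt (edge_ratio 1 s)) (Num.sqrt (edge_ratio (- 1) s))).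
  by apply/funext => s; exact: rateE.
have cr eps : eps ^+ 2 = 1 -> continuous (fun s => Num.sqrt (edge_ratio eps s)).
  move=> eps2 s; apply: (@continuous_comp _ _ _ (edge_ratio eps) Num.sqrt);
    last exact: sqrt_continuous.
  rewrite /edge_ratio; apply: cvgM; first exact: continuous_edge_energy.
  apply: cvgV; last exact: continuous_edge_energy.
  by rewrite gt_eqF// edge_energy_gt0// addr_gt0// divr_gt0.
move=> s.
have c1 : {for s, continuous (fun s => Num.sqrt (edge_ratio 1 s))}.
  by apply: cr; rewrite expr1n.
have c2 : {for s, continuous (fun s => Num.sqrt (edge_ratio (- 1) s))}.
  by apply: cr; rewrite sqrrN expr1n.
exact: (continuous_max c1 c2).
Qed.

End Rate.

(** * The bound and when it is less than 1 *)

Section Bound.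
Variable R : realType.

(** The supremum runs over all real ratios s > 0, not only over the Fourier
    numbers divided by one particular k; this is what makes it independent of
    k, and also of the height of the guide. *)
Definition rate_bound (sigma L delta : R) : R :=
  sup [set rate sigma L delta s | s in [set s : R | 0 < s]].

Section Fixed.
Variables sigma L delta : R.
Hypotheses (sigma_gt0 : 0 < sigma) (L_gt0 : 0 < L) (delta_gt0 : 0 < delta).
Local Notation decay s := (complex.Re (zeta 1 sigma s)).

(** If c decreased while the product c d stayed fixed, then d would increase and
    c ^ 2 - d ^ 2 = s ^ 2 - 1 would decrease. *)
Lemma Re_zeta1_ge (s t : R) : 0 <= s -> s <= t -> decay s <= decay t.
Proof.
move=> s0 st; have ds := Re_zeta1_gt0 sigma_gt0 s; have dt := Re_zeta1_gt0 sigma_gt0 t.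
have st2 : s ^+ 2 <= t ^+ 2 by rewrite lerXn2r ?nnegrE ?(le_trans s0).
rewrite leNgt; apply/negP => lt.
have fs := Im_zeta1_gt0 sigma_gt0 s; have ft := Im_zeta1_gt0 sigma_gt0 t.
have is_ := zeta1_sqr_Im sigma s; have it := zeta1_sqr_Im sigma t.
have rs := zeta1_sqr_Re sigma s; have rt := zeta1_sqr_Re sigma t.
have ltf : complex.Im (zeta 1 sigma s) < complex.Im (zeta 1 sigma t).
  rewrite ltNge; apply/negP => le.
  have : decay t * complex.Im (zeta 1 sigma t) < decay s * complex.Im (zeta 1 sigma s).
    apply: (@lt_le_trans _ _ (decay s * complex.Im (zeta 1 sigma t))).
      by rewrite ltr_pM2r.
    by rewrite ler_pM2l.
  lra.
have c2 : decay t ^+ 2 < decay s ^+ 2 by rewrite ltr_pXn2r// ?nnegrE ltW.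
have d2 : complex.Im (zeta 1 sigma s) ^+ 2 < complex.Im (zeta 1 sigma t) ^+ 2.
  by rewrite ltr_pXn2r// ?nnegrE ltW.
lra.
Qed.

Lemma Re_zeta1_ge_linear (s : R) : 1 <= s -> s - 1 <= decay s.
Proof.
move=> s1; rewrite -(@ler_pXn2r _ 2%N) ?nnegrE ?subr_ge0//
  ?(ltW (Re_zeta1_gt0 sigma_gt0 s))//.
have := zeta1_sqr_Re sigma s; have := sqr_ge0 (complex.Im (zeta 1 sigma s)).
have -> : (s - 1) ^+ 2 = s ^+ 2 - 2 * s + 1 by ring.
move: s1; lra.
Qed.

(** The slowest mode, s = 0, has the smallest attenuation, so it controls all the
    others. *)
Lemma rate_le_of_decay (s X Y : R) : 0 <= s ->
  expR (- (decay 0 * L)) <= X -> expR (- (2 * decay 0 * delta)) <= Y ->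
  X * Y < 1 -> rate sigma L delta s <= (X + Y) / (1 - X * Y).
Proof.
move=> s0 hX hY; apply: rate_le => //.
  apply: le_trans hX; rewrite ler_expR lerN2 ler_pM2r//.
  exact: Re_zeta1_ge.
apply: le_trans hY; rewrite ler_expR lerN2 ler_pM2r// ler_pM2l//.
exact: Re_zeta1_ge.
Qed.

Let X0 := expR (- (decay 0 * L)).
Let Y0 := expR (- (2 * decay 0 * delta)).

Let X0_lt1 : X0 < 1.
Proof. by rewrite expR_lt1 oppr_lt0 mulr_gt0// Re_zeta1_gt0. Qed.

Let Y0_lt1 : Y0 < 1.
Proof. by rewrite expR_lt1 oppr_lt0 !mulr_gt0// Re_zeta1_gt0. Qed.

Let X0Y0_lt1 : X0 * Y0 < 1.
Proof. by rewrite mulr_ilt1// expR_ge0. Qed.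

Lemma has_sup_rate : has_sup [set rate sigma L delta s | s in [set s : R | 0 < s]].
Proof.
split; first by exists (rate sigma L delta 1); exists 1 => //=.
exists ((X0 + Y0) / (1 - X0 * Y0)) => _ [s /= s0 <-].
by apply: rate_le_of_decay => //; exact: ltW.
Qed.

Lemma rate_le_bound (s : R) : 0 < s -> rate sigma L delta s <= rate_bound sigma L delta.
Proof.
by move=> s0; apply: ub_le_sup; [exact: has_sup_rate.2 | exists s].
Qed.

Lemma rate_bound_le (q : R) : (forall s, 0 < s -> rate sigma L delta s <= q) ->
  rate_bound sigma L delta <= q.
Proof.
move=> H; apply: ge_sup; first exact: has_sup_rate.1.
by move=> _ [s /= s0 <-]; exact: H.
Qed.

(** Far evanescent modes are damped strongly: Re z grows like s, and once both
    exponentials are below 1 / 10 the bound is 20 / 99. *)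
Lemma rate_le_half : exists2 S : R, 0 <= S &
  forall s, S <= s -> rate sigma L delta s <= 2^-1.
Proof.
exists (1 + 9 / L + 9 / delta); first by rewrite !addr_ge0// divr_ge0// ltW.
move=> s sS.
have s1 : 1 <= s.
  by apply: le_trans sS; rewrite -addrA lerDl addr_ge0// divr_ge0// ltW.
have ds := Re_zeta1_ge_linear s1.
have small x : 9 <= x -> expR (- x) <= 10^-1 :> R.
  move=> x9; rewrite expRN lef_pV2 ?posrE ?expR_gt0//.
  by have := expR_ge1Dx x; lra.
have L9 : 0 <= 9 / L by rewrite divr_ge0// ltW.
have d9 : 0 <= 9 / delta by rewrite divr_ge0// ltW.
have := @rate_le _ sigma L delta sigma_gt0 L_gt0 delta_gt0 s 10^-1 10^-1.
have -> : (10^-1 + 10^-1) / (1 - 10^-1 * 10^-1) = 20 / 99 :> R by field.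
move=> H; apply: (@le_trans _ _ (20 / 99)); last by lra.
apply: H; last by lra.
  by apply: small; rewrite -ler_pdivrMr//; lra.
apply: small; rewrite -ler_pdivrMr//.
have := Re_zeta1_gt0 sigma_gt0 s; lra.
Qed.

(** A pointwise bound below 1 does not control the supremum by itself; on the
    compact interval [0, S] the maximum is attained, and beyond S the rate is
    at most 1 / 2. *)
Lemma rate_bound_lt1 : 1 <= sigma -> rate_bound sigma L delta < 1.
Proof.
move=> s1; have [S S0 hS] := rate_le_half.
have cr : {within `[0, S], continuous (rate sigma L delta)}.
  by apply: continuous_subspaceT => s; exact: continuous_rate.
have [c _ hc] := EVT_max S0 cr.
apply: (@le_lt_trans _ _ (Num.max (rate sigma L delta c) 2^-1)).
  apply: rate_bound_le => s s0; rewrite le_max.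
  have [sS|Ss] := leP s S; last by rewrite hS ?orbT// ltW.
  by rewrite hc// in_itv/= sS ltW.
by rewrite gt_max rate_lt1//=; lra.
Qed.

End Fixed.

(** The condition on [X] and [Y] says exactly that (X + Y) / (1 - X Y) < 1. *)
Lemma rate_bound_lt1_of_decay (sigma L delta : R) :
  0 < sigma -> 0 < L -> 0 < delta ->
  let X := expR (- (complex.Re (zeta 1 sigma 0) * L)) in
  let Y := expR (- (2 * complex.Re (zeta 1 sigma 0) * delta)) in
  X + Y + X * Y < 1 -> rate_bound sigma L delta < 1.
Proof.
move=> s0 L0 d0 X Y XY; have X0 : 0 < X := expR_gt0 _; have Y0 : 0 < Y := expR_gt0 _.
have XY1 : X * Y < 1 by lra.
apply: (@le_lt_trans _ _ ((X + Y) / (1 - X * Y))).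
  by apply: rate_bound_le => // s s_gt0; apply: rate_le_of_decay => //; exact: ltW.
by rewrite ltr_pdivrMr ?subr_gt0//; lra.
Qed.

(** The inequality in X = e ^ (- c t) amounts to X < (1 - Y) / (1 + Y), a positive
    number. *)
Lemma expR_small_threshold (c Y : R) : 0 < c -> 0 < Y -> Y < 1 ->
  exists T : R, forall t, 0 < t -> T < t ->
    expR (- (c * t)) + Y + expR (- (c * t)) * Y < 1.
Proof.
move=> c0 Y0 Y1; pose e := (1 - Y) / (1 + Y).
have e0 : 0 < e by rewrite divr_gt0 ?subr_gt0// addr_gt0.
exists (e^-1 / c) => t t0 lt.
have h : expR (- (c * t)) < e.
  rewrite expRN -[ltRHS]invrK ltf_pV2 ?posrE ?expR_gt0 ?invr_gt0//.
  rewrite ltr_pdivrMr// mulrC in lt.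
  have := expR_ge1Dx (c * t); lra.
move: h; rewrite ltr_pdivlMr ?addr_gt0//; lra.
Qed.

Lemma rate_bound_lt1_large_L (sigma delta : R) : 0 < sigma -> 0 < delta ->
  exists Ls : R, forall L, 0 < L -> Ls < L -> rate_bound sigma L delta < 1.
Proof.
move=> s0 d0; have c0 := Re_zeta1_gt0 s0 0.
have Y1 : expR (- (2 * complex.Re (zeta 1 sigma 0) * delta)) < 1.
  by rewrite expR_lt1 oppr_lt0 !mulr_gt0.
have [T hT] := expR_small_threshold c0 (expR_gt0 _) Y1.
by exists T => L L0 TL; apply: rate_bound_lt1_of_decay => //; exact: hT.
Qed.

Lemma rate_bound_lt1_large_delta (sigma L : R) : 0 < sigma -> 0 < L ->
  exists deltas : R, forall delta, 0 < delta -> deltas < delta ->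
    rate_bound sigma L delta < 1.
Proof.
move=> s0 L0; have c0 : 0 < 2 * complex.Re (zeta 1 sigma 0).
  by rewrite mulr_gt0// Re_zeta1_gt0.
have X1 : expR (- (complex.Re (zeta 1 sigma 0) * L)) < 1.
  by rewrite expR_lt1 oppr_lt0 !mulr_gt0// Re_zeta1_gt0.
have [T hT] := expR_small_threshold c0 (expR_gt0 _) X1.
exists T => delta d0 Td; apply: rate_bound_lt1_of_decay => //=.
by have := hT _ d0 Td; lra.
Qed.

End Bound.

(** * Fourier numbers of the wave guide *)

Section WaveGuide.
Variable R : realType.
Variables Lhat sigma0 L0 delta0 : R.
Hypotheses (Lhat_gt0 : 0 < Lhat) (sigma0_gt0 : 0 < sigma0) (L0_gt0 : 0 < L0)
  (delta0_gt0 : 0 < delta0).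
Implicit Types (k : R) (m : nat).

Lemma cvg_spectral_radius_T1d_fourier k m : 0 < k ->
  spectral_radius (T1d k (sigma0 * k) (L0 * k^-1) (delta0 * k^-1) N
    (fourier_number Lhat m)) @[N --> \oo]
  --> rate sigma0 L0 delta0 (fourier_number Lhat m / k).
Proof.
move=> k0; under eq_fun do rewrite T1d_scale//.
exact: cvg_spectral_radius_T1d.
Qed.

Lemma R1d_rate k m : 0 < k ->
  R1d k (sigma0 * k) (L0 * k^-1) (delta0 * k^-1) (fourier_number Lhat m)
  = rate sigma0 L0 delta0 (fourier_number Lhat m / k).
Proof. by move=> k0; apply: cvg_lim => //; exact: cvg_spectral_radius_T1d_fourier. Qed.

Lemma fourier_number_div_gt0 k m : 0 < k -> (0 < m)%N -> 0 < fourier_number Lhat m / k.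
Proof. by move=> k0 m0; rewrite !divr_gt0// mulr_gt0 ?ltr0n// pi_gt0. Qed.

Lemma R2d_le_bound k : 0 < k ->
  (R2d k (sigma0 * k) (L0 * k^-1) (delta0 * k^-1) Lhat
   <= (rate_bound sigma0 L0 delta0)%:E)%E.
Proof.
move=> k0; apply: ge_ereal_sup => _ [m m0 <-].
by rewrite lee_fin R1d_rate// rate_le_bound// fourier_number_div_gt0.
Qed.

Lemma rate_le_R2d k m : 0 < k -> (0 < m)%N ->
  ((rate sigma0 L0 delta0 (fourier_number Lhat m / k))%:E
   <= R2d k (sigma0 * k) (L0 * k^-1) (delta0 * k^-1) Lhat)%E.
Proof. by move=> k0 m0; apply: ereal_sup_ubound; exists m => //; rewrite R1d_rate. Qed.

(** The ratios kt / k form an arithmetic progression of step pi / (Lhat * k),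
    which is finer than [eta] for the stated [k]. *)
Lemma fourier_number_dense (s eta k : R) : 0 < s -> 0 < eta ->
  pi / (Lhat * eta) < k ->
  exists2 m, (0 < m)%N & `|s - fourier_number Lhat m / k| < eta.
Proof.
move=> s0 eta0 lk.
have k0 : 0 < k by apply: lt_trans lk; rewrite divr_gt0 ?pi_gt0// mulr_gt0.
pose h := pi / Lhat / k.
have h0 : 0 < h by rewrite !divr_gt0// pi_gt0.
have heta : h < eta.
  rewrite ltr_pdivrMr// ltr_pdivrMr//.
  by move: lk; rewrite ltr_pdivrMr ?mulr_gt0//; lra.
have /truncn_itv/andP[lo hi] : 0 <= s / h by rewrite divr_ge0// ltW.
exists (Num.truncn (s / h)).+1 => //.
have -> : fourier_number Lhat (Num.truncn (s / h)).+1 / k = (Num.truncn (s / h)).+1%:R * h.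
  by rewrite /fourier_number /h; ring.
rewrite ler_pdivlMr// in lo; rewrite ltr_pdivrMr// in hi.
rewrite ltr_norml; apply/andP; split; last lra.
rewrite -natr1 mulrDl mul1r; lra.
Qed.

(** A ratio [s] that nearly realises the supremum is approached by actual Fourier
    numbers once k is large, and the rate is continuous there. *)
Lemma cvg_R2d_bound :
  R2d k (sigma0 * k) (L0 * k^-1) (delta0 * k^-1) Lhat @[k --> +oo]
  --> (rate_bound sigma0 L0 delta0)%:E.
Proof.
pose F k := R2d k (sigma0 * k) (L0 * k^-1) (delta0 * k^-1) Lhat.
have fin k : 0 < k -> F k \is a fin_num.
  move=> k0; rewrite fin_numE -ltNye -ltey.
  rewrite (le_lt_trans (R2d_le_bound k0)) ?ltry// andbT.
  exact: lt_le_trans (ltNyr _) (@rate_le_R2d k 1 k0 isT).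
apply/fine_cvgP; split.
  by near=> k; apply: fin; near: k; apply: nbhs_pinfty_gt; exact: num_real.
apply/cvgrPdist_le => e e0.
have [_ [s /= s0 <-] lts] := sup_adherent e0 (has_sup_rate sigma0_gt0 L0_gt0 delta0_gt0).
rewrite -/(rate_bound sigma0 L0 delta0) in lts.
have gap : 0 < rate sigma0 L0 delta0 s - (rate_bound sigma0 L0 delta0 - e).
  by rewrite subr_gt0.
have /cvgrPdist_lt/(_ _ gap) :=
  @continuous_rate R sigma0 L0 delta0 sigma0_gt0 L0_gt0 delta0_gt0 s.
move=> /nbhs_ballP[eta /= eta0 ball_eta].
near=> k.
have k0 : 0 < k by near: k; apply: nbhs_pinfty_gt; exact: num_real.
have klarge : pi / (Lhat * eta) < k by near: k; apply: nbhs_pinfty_gt; exact: num_real.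
have [m m0 hm] := fourier_number_dense s0 eta0 klarge.
have := ball_eta _ hm; rewrite /= => hr.
have up : fine (F k) <= rate_bound sigma0 L0 delta0.
  by rewrite -lee_fin fineK ?fin//; exact: R2d_le_bound.
have lo : rate sigma0 L0 delta0 (fourier_number Lhat m / k) <= fine (F k).
  by rewrite -lee_fin fineK ?fin//; exact: rate_le_R2d.
rewrite ger0_norm ?subr_ge0//.
move: hr; rewrite ltr_norml => /andP[_ hr]; rewrite -/(F k); lra.
Unshelve. all: by end_near. Qed.

End WaveGuide.

Unset Implicit Arguments.

Theorem corollary4p7 (R : realType) (Lhat : R) (hLhat : 0 < Lhat) :
  (* spectral radius of the iteration matrix of mode m with N subdomains *)
  let rho (sigma0 L0 delta0 k : R) (m N : nat) : R :=
    spectral_radius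
      (T1d k (sigma0 * k) (L0 * k^-1) (delta0 * k^-1) N
         (fourier_number Lhat m)) in
  let R2 (sigma0 L0 delta0 k : R) : \bar R :=
    R2d k (sigma0 * k) (L0 * k^-1) (delta0 * k^-1) Lhat in
  exists bound : R -> R -> R -> R,
    let robust (sigma0 L0 delta0 : R) : Prop :=
      [/\ bound sigma0 L0 delta0 < 1,
          forall k : R, 0 < k -> (R2 sigma0 L0 delta0 k < 1%:E)%E
        & (* a convergence rate valid for all k and all large N *)
          exists2 q : R, q < 1 &
            forall (k : R) (m : nat), 0 < k -> (0 < m)%N ->
              \forall N \near \oo, rho sigma0 L0 delta0 k m N <= q] in
    [/\ forall sigma0 L0 delta0 : R, 0 < sigma0 -> 0 < L0 -> 0 < delta0 ->
          [/\ (* the limits defining R_1d exist *)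
              forall (k : R) (m : nat), 0 < k -> (0 < m)%N ->
                cvgn (rho sigma0 L0 delta0 k m),
              forall k : R, 0 < k ->
                (R2 sigma0 L0 delta0 k <= (bound sigma0 L0 delta0)%:E)%E
            & R2 sigma0 L0 delta0 k @[k --> +oo] -->
                (bound sigma0 L0 delta0)%:E],
        forall L0 delta0 : R, 0 < L0 -> 0 < delta0 ->
          exists sigmas : R, forall sigma0 : R, 0 < sigma0 -> sigmas < sigma0 ->
            robust sigma0 L0 delta0,
        forall sigma0 delta0 : R, 0 < sigma0 -> 0 < delta0 ->
          exists Ls : R, forall L0 : R, 0 < L0 -> Ls < L0 ->
            robust sigma0 L0 delta0,
        forall sigma0 L0 : R, 0 < sigma0 -> 0 < L0 ->
          exists deltas : R, forall delta0 : R, 0 < delta0 -> deltas < delta0 ->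
            robust sigma0 L0 delta0
      & forall sigma0 L0 delta0 : R, 1 <= sigma0 -> 0 < L0 -> 0 < delta0 ->
          robust sigma0 L0 delta0].
Proof.
move=> rho R2.
exists (@rate_bound R) => robust.
have robustP sigma0 L0 delta0 : 0 < sigma0 -> 0 < L0 -> 0 < delta0 ->
    rate_bound sigma0 L0 delta0 < 1 -> robust sigma0 L0 delta0.
  move=> s0 l0 d0 b1; split=> //.
    by move=> k k0; apply: le_lt_trans (R2d_le_bound hLhat s0 l0 d0 k0) _; rewrite lte_fin.
  exists ((1 + rate_bound sigma0 L0 delta0) / 2); first by lra.
  move=> k m k0 m0.
  have /cvgr_le := @cvg_spectral_radius_T1d_fourier R Lhat _ _ _ s0 l0 d0 k m k0.
  apply.
  have := rate_le_bound s0 l0 d0 (fourier_number_div_gt0 hLhat k0 m0); lra.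
split.
- move=> sigma0 L0 delta0 s0 l0 d0; split.
  + move=> k m k0 m0; apply/cvg_ex.
    by exists (rate sigma0 L0 delta0 (fourier_number Lhat m / k));
      exact: cvg_spectral_radius_T1d_fourier.
  + by move=> k k0; exact: R2d_le_bound.
  + exact: cvg_R2d_bound.
- move=> L0 delta0 l0 d0; exists 1 => sigma0 s0 s1.
  by apply: robustP => //; apply: rate_bound_lt1 => //; exact: ltW.
- move=> sigma0 delta0 s0 d0; have [T hT] := rate_bound_lt1_large_L s0 d0.
  by exists T => L0 l0 TL; apply: robustP => //; exact: hT.
- move=> sigma0 L0 s0 l0; have [T hT] := rate_bound_lt1_large_delta s0 l0.
  by exists T => delta0 d0 Td; apply: robustP => //; exact: hT.
- move=> sigma0 L0 delta0 s1 l0 d0; have s0 : 0 < sigma0 by exact: lt_le_trans s1.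
  by apply: robustP => //; exact: rate_bound_lt1.
Qed.
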